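(* Assume the standing assumptions listed in the context and that for some $a_0>0$, $b_0\in\mathbb R$, $$J'(z)\ge a_0(\ln z)^3+b_0\qquad\text{for all } z>0 .$$ Then there exists a positive constant $K$ such that, whenever the initial curve satisfies $r_0(x)>K$ for all $x\in[0,T^\ast]$, there is no solution $r$ of the equation $$r(t,x)=\tilde a(t,x)\,\exp\Big(\int_0^t J'\Big(\int_0^{t-s+x}\tilde\lambda(s,v)r(s,v)\,dv\Big)\tilde\lambda(s,t-s+x)\,ds\Big),\qquad t\in[0,T^\ast],\ x\ge0,$$ taking values in $\mathbb L^{2,\gamma}_+$ with probability one, i.e. with $P(r\in\mathbb L^{2,\gamma}_+)=1$.
   Context: Fix $T^\ast\in(0,+\infty)$, $\gamma>0$ and a filtered probability space $(\Omega,(\mathcal F_t)_{t\ge0},P)$ carrying a real-valued Lévy process $L$ with Lévy exponent $J$: $\mathbf E(e^{-zL(t)})=e^{tJ(z)}$, $$J(z)=-az+\tfrac12 qz^2+\int_{\mathbb R}\big(e^{-zy}-1+zy\mathbf 1_{(-1,1)}(y)\big)\,\nu(dy),$$ where $a\in\mathbb R$, $q\ge0$ and the Lévy measure $\nu$ satisfies $\int_{\mathbb R}(y^2\wedge1)\,\nu(dy)<\infty$. Write $\triangle L(s)=L(s)-L(s-)$. Let $\tilde\lambda:\mathbb R_+\times\mathbb R_+\to\mathbb R$ be a deterministic function with $\tilde\lambda(\cdot,x)$ continuous for each $x\ge0$ and $\underline\lambda:=\inf_{t\in[0,T^\ast],x\ge0}\tilde\lambda(t,x)>0$, $\bar\lambda:=\sup_{t\in[0,T^\ast],x\ge0}\tilde\lambda(t,x)<+\infty$.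 Let $r_0:\mathbb R_+\to\mathbb R$ be a deterministic initial curve. Standing assumptions: (A1) $r_0$ is positive. (A2) The support of $\nu$ is contained in $(-1/\bar\lambda,+\infty)$. (A3) The random field $|\int_0^t\tilde\lambda(s,t-s+x)\,dL(s)|$ is bounded in $(t,x)\in[0,T^\ast]\times[0,+\infty)$ (almost surely). (A4) $\int_{(-1/\bar\lambda,1)}y^2\,\nu(dy)+\int_1^\infty y\,\nu(dy)<\infty$. (Under these, $J'$ is finite on $[0,+\infty)$.) Define $\tilde a(t,x)=r_0(t+x)\,\tilde b(t,x)$ with $$\tilde b(t,x)=e^{\int_0^t\tilde\lambda(s,t-s+x)dL(s)-\frac q2\int_0^t\tilde\lambda^2(s,t-s+x)ds}\prod_{0\le s\le t}\big(1+\tilde\lambda(s,t-s+x)\triangle L(s)\big)e^{-\tilde\lambda(s,t-s+x)\triangle L(s)}.$$ Spaces: $L^{2,\gamma}_+$ is the set of $h:\mathbb R_+\to\mathbb R_+$ with $\|h\|^2_{L^{2,\gamma}_+}=\int_0^\infty|h(x)|^2e^{\gamma x}dx<\infty$; $\mathbb L^{2,\gamma}_+$ is the set of $h:[0,T^\ast]\times[0,+\infty)\to\mathbb R_+$ with $\sup_{t\in[0,T^\ast]}\|h(t,\cdot)\|^2_{L^{2,\gamma}_+}<\infty$. A solution $r$ is a random field satisfying the equation such that $r(\cdot,x)$ is adapted and càdlàg on $[0,T^\ast]$ for each $x\ge0$. *)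

(* Defs.v *)
From HB Require Import structures.
From mathcomp Require Import all_boot all_order all_algebra finmap.
From mathcomp Require Import all_classical all_reals all_analysis.
From mathcomp Require summability.
Import Order.TTheory GRing.Theory Num.Theory.
Import numFieldNormedType.Exports.

Set Implicit Arguments.
Unset Strict Implicit.
Unset Printing Implicit Defensive.

Local Open Scope classical_set_scope.
Local Open Scope ring_scope.

(* Time and space are the half-line [0, +oo), embedded in R: functions on it
   are total on R, and only their values at nonnegative points are used. *)

Section Paths.
Context {R : realType}.
Implicit Types (f : R -> R) (D : set R) (s t : R).

(* At an endpoint of D the filter of the missing side is trivial, so that the
   corresponding condition is void there. *)
Definition cadlag_on D f : Prop := forall t, D t ->
  f u @[u --> within D t^'+] --> f t /\ cvg (f u @[u --> within D t^'-]).

(* f(t) - f(t-), with the convention f(0-) = f(0). *)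
Definition jump f t : R :=
  if 0 < t then f t - lim (f u @[u --> t^'-]) else 0.

(* Possibly uncountable product, as the limit of the finite products along
   the finite subsets of A ordered by inclusion. *)
Definition unordered_prod (A : set R) f : R :=
  lim ((fun B : {fset R} => \prod_(s <- B | s \in A) f s)
         @ @summability.totally R).

End Paths.

Section LevyTriplet.
Context {R : realType}.
Implicit Types (nu : {measure set (measurableTypeR R) -> \bar R}) (a q z : R).

Definition is_levy_measure nu : Prop :=
  nu [set 0] = 0%E /\ (\int[nu]_y (Num.min (y ^+ 2) 1)%:E < +oo)%E.

Definition measure_support nu : set R :=
  [set y | forall U : set R, open U -> U y -> (0 < nu U)%E].

Definition levy_exponent a q nu z : R :=
  - a * z + q / 2 * z ^+ 2 +
  \int[nu]_y (expR (- (z * y)) - 1 + z * y * \1_(`]-1, 1[ : set R) y).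

(* J is in general infinite to the left of 0, so its derivative on the
   half-line [0, +oo) is one-sided at 0. *)
Definition levy_exponent_deriv a q nu z : R :=
  let J := levy_exponent a q nu in
  if 0 < z then derive1 J z
  else lim ((J (z + h) - J z) / h @[h --> 0^'+]).

End LevyTriplet.

Section Processes.
Context {d : measure_display} {T : measurableType d} {R : realType}.
Variable P : probability T R.
Implicit Types (F : R -> set (set T)) (L : R -> T -> R).

Definition is_filtration F : Prop :=
  [/\ forall t : R, 0 <= t -> sigma_algebra setT (F t),
      forall t : R, 0 <= t -> forall A, F t A -> measurable A &
      forall s t : R, 0 <= s -> s <= t -> F s `<=` F t].

Definition adapted_on (D : set R) F (X : R -> T -> R) : Prop :=
  forall t, D t -> forall B : set R, measurable B -> F t (X t @^-1` B).

Record is_levy_process F L : Prop := {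
  levy_adapted : adapted_on `[0, +oo[ F L ;
  levy_zero : {ae P, forall w, L 0 w = 0} ;
  levy_cadlag : {ae P, forall w, cadlag_on `[0, +oo[ (L ^~ w)} ;
  levy_indep : forall s t : R, 0 <= s -> s <= t ->
    forall (A : set T) (B : set R), F s A -> measurable B ->
      P (A `&` [set w | B (L t w - L s w)%R]) =
      (P A * P [set w | B (L t w - L s w)%R])%E ;
  levy_stationary : forall s t : R, 0 <= s -> s <= t ->
    forall B : set R, measurable B ->
      P [set w | B (L t w - L s w)%R] = P [set w | B (L (t - s)%R w)] }.

(* The Laplace transform of L(t) is finite exactly for the z at which the
   integral of exp(- z y) over the large jumps y is finite. *)
Definition has_levy_exponent L a q
    (nu : {measure set (measurableTypeR R) -> \bar R}) : Prop :=
  forall z : R,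
    (\int[nu]_(y in [set y : R | (1 <= `|y|)%R]) (expR (- (z * y)))%:E < +oo)%E ->
  forall t : R, 0 <= t ->
    ('E_P[fun w => expR (- (z * L t w))] =
     (expR (t * levy_exponent a q nu z))%:E)%E.

(* A step function sum_i c_i 1_(u_i, v_i] is encoded by the list of the
   triples (c_i, (u_i, v_i)). *)
Definition step_fun (p : seq (R * (R * R))) (s : R) : R :=
  \sum_(c <- p) c.1 * \1_(`]c.2.1, c.2.2] : set R) s.

Definition step_integral L (p : seq (R * (R * R))) (w : T) : R :=
  \sum_(c <- p) c.1 * (L c.2.2 w - L c.2.1 w).

Definition cvg_in_probability (X : nat -> T -> R) (Y : T -> R) : Prop :=
  forall e : R, 0 < e -> P [set w | e <= `|X n w - Y w|] @[n --> \oo] --> 0%E.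

(* Y is a version of the stochastic integral of the bounded deterministic
   function f over (0, t] with respect to L: the integrals of uniformly bounded
   step functions converging to f almost everywhere converge to Y in
   probability. By dominated convergence for stochastic integrals, Y does not
   depend on the approximating sequence, up to a null set. *)
Definition is_levy_integral L (f : R -> R) (t : R) (Y : T -> R) : Prop :=
  measurable_fun setT Y /\
  exists (p : nat -> seq (R * (R * R))) (C : R),
    [/\ forall n c, c \in p n -> [/\ 0 <= c.2.1, c.2.1 <= c.2.2 & c.2.2 <= t],
        forall n s, `|step_fun (p n) s| <= C,
        {ae (@lebesgue_measure R), forall s : R, 0 < s -> s <= t ->
          step_fun (p n) s @[n --> \oo] --> f s} &
        cvg_in_probability (fun n => step_integral L (p n)) Y].

End Processes.

Section Equation.
Context {d : measure_display} {T : measurableType d} {R : realType}.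
Variable P : probability T R.
Implicit Types (lam : R -> R -> R) (Tstar t x : R).
Local Notation mu := (@lebesgue_measure R).

Definition lam_values lam Tstar : set R :=
  [set y | exists t x : R, [/\ 0 <= t <= Tstar, 0 <= x & y = lam t x]].

Definition lam_sup lam Tstar : R := sup (lam_values lam Tstar).

Definition lam_inf lam Tstar : R := inf (lam_values lam Tstar).

(* Throughout, I t x is the stochastic integral of lam(s, t - s + x) with
   respect to dL(s) over s in [0, t]. *)
Definition btilde lam (q : R) (L : R -> T -> R) (I : R -> R -> T -> R)
    t x (w : T) : R :=
  expR (I t x w - q / 2 * \int[mu]_(s in `[0, t]) (lam s (t - s + x)) ^+ 2) *
  unordered_prod `[0, t] (fun s =>
    let u := lam s (t - s + x) * jump (L ^~ w) s in (1 + u) * expR (- u)).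

Definition atilde (r0 : R -> R) lam (q : R) (L : R -> T -> R) (I : R -> R -> T -> R)
    t x (w : T) : R :=
  r0 (t + x) * btilde lam q L I t x w.

Definition drift lam (a q : R)
    (nu : {measure set (measurableTypeR R) -> \bar R})
    (r : R -> R -> T -> R) t x (w : T) (s : R) : R :=
  levy_exponent_deriv a q nu
    (\int[mu]_(v in `[0, t - s + x]) (lam s v * r s v w)) *
  lam s (t - s + x).

(* The integral over s is extended-valued: if it diverges to +oo, the right-hand
   side is +oo and the equation fails. *)
Definition satisfies_equation (r0 : R -> R) lam (a q : R)
    (nu : {measure set (measurableTypeR R) -> \bar R})
    (L : R -> T -> R) (I r : R -> R -> T -> R) t x (w : T) : Prop :=
  ((r t x w)%:E = (atilde r0 lam q L I t x w)%:E *
    expeR (\int[mu]_(s in `[0%R, t]) (drift lam a q nu r t x w s)%:E))%E.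

Record is_solution (F : R -> set (set T)) Tstar (r0 : R -> R) lam (a q : R)
    (nu : {measure set (measurableTypeR R) -> \bar R})
    (L : R -> T -> R) (I r : R -> R -> T -> R) : Prop := {
  solution_adapted : forall x : R, 0 <= x ->
    adapted_on `[0, Tstar] F (fun t => r t x) ;
  solution_cadlag : forall x : R, 0 <= x ->
    {ae P, forall w, cadlag_on `[0, Tstar] (fun t => r t x w)} ;
  solution_equation : {ae P, forall w, forall t x : R, 0 <= t <= Tstar -> 0 <= x ->
    satisfies_equation r0 lam a q nu L I r t x w} }.

Definition L2gamma_norm2 (gamma : R) (h : R -> R) : \bar R :=
  (\int[mu]_(x in `[0%R, +oo[) (`|h x| ^+ 2 * expR (gamma * x))%:E)%E.

Definition in_LL2gamma Tstar (gamma : R) (h : R -> R -> R) : Prop :=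
  [/\ forall t x : R, 0 <= t <= Tstar -> 0 <= x -> 0 <= h t x,
      forall t : R, 0 <= t <= Tstar -> measurable_fun (`[0, +oo[ : set R) (h t) &
      (ereal_sup [set L2gamma_norm2 gamma (h t) | t in `[0%R, Tstar]] < +oo)%E].

End Equation.

(* Main.v *)
Require Import Defs.
From HB Require Import structures.
From mathcomp Require Import all_boot all_order all_algebra finmap.
From mathcomp Require Import all_classical all_reals all_analysis.
From mathcomp Require Import measurable_realfun.
From mathcomp Require summability.
From mathcomp Require Import ring lra.
Import Order.TTheory GRing.Theory Num.Theory.
Import numFieldNormedType.Exports.

Set Implicit Arguments.
Unset Strict Implicit.
Unset Printing Implicit Defensive.

Local Open Scope classical_set_scope.
Local Open Scope ring_scope.

(** The drift term of the equation feeds the solution back into itself, and its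
    growth is superlinear on a logarithmic scale, which produces an explosion.

    Fix a path and write f(t, y) = r(t, y - t) for t <= y. The equation says that
    f(t, y) is at least a constant times the exponential of the integral over
    s <= t of J'(z(s, y)) lambda, where z(s, y) is the integral of lambda f(s, u)
    over u in [s, y]. If f >= exp(h) for s >= tau and u >= v, then
    ln z(s, y) is at least h, up to the logarithm of the length y - v, and hence
    J'(z) is of order h^3. Waiting for a time delta and moving delta to the right
    multiplies f by exp(const * delta * h^3). With the geometric steps
    delta_n = T 2^(-n-2), the lower bound exp(H 2^n) at level n implies
    exp(H 2^(n+1)) at level n + 1 as soon as H is large, since 2^(-n) (2^n)^3
    exceeds 2^n. All levels are reached before time T/2 at maturity T, so that
    the real number r(T/2, T/2) would be infinite: this is [blow_up]. Membership
    in the weighted L^2 space serves to keep every z(s, y) finite, and the cubic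
    bound has to be supplemented by a bound on J' from below near 0, where
    (ln z)^3 is very negative ([levy_exponent_deriv_bounded_below]: J is convex
    and its slope at 0 is controlled by the first moment of the large jumps).

    The remaining point is probabilistic. The constant in front of the
    exponential is r_0 times the stochastic exponential b(t, x), so that some
    deterministic level must stay below b, uniformly in (t, x), with positive
    probability. Almost surely b is bounded below by a positive random constant
    ([ae_btilde_bounded_below]), which is enough by countable additivity. The
    exponential part of b is controlled by the assumed bound on the stochastic
    integrals. The product of the factors (1 + u) exp(-u), u = lambda * jump, is
    bounded below as soon as the squares of the jumps are summable and every jump
    exceeds -1 / sup lambda ([unordered_prod_compensated_bounded_below]). Both
    facts come from a single estimate. For phi(x) = (exp(-z x) - 1)^2, the sum of
    phi over the jumps of a path is at most the lower limit of its sum over the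
    increments along a regular grid ([sum_jumps_le_liminf]), and by Fatou and the
    formula for the Laplace transform the mean of that lower limit is at most
    T (J(2z) - 2 J(z)). With z = 1 this bounds the squares of the jumps. As z
    tends to infinity, J(2z) - 2 J(z) grows at most like z^2 exp(2 z c) if nu
    charges only (-c, oo), while a jump at or below -k would contribute about
    exp(2 z k): for c < k such jumps have probability zero. *)

(** * Monotonicity and elementary inequalities *)

(** The integral is a difference of two suprema over simple functions, hence it
    is monotone on arbitrary functions. Neither the drift nor the volatility
    s |-> lam s (t - s + x) is assumed measurable, so that this form is needed. *)
Lemma le_integral_monotone d (T : measurableType d) (R : realType)
    (mu : {measure set T -> \bar R}) (D : set T) (f g : T -> \bar R) :
  (forall x, D x -> (f x <= g x)%E) ->
  (\int[mu]_(x in D) f x <= \int[mu]_(x in D) g x)%E.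
Proof.
move=> fg; have le_restrict x : ((f \_ D) x <= (g \_ D) x)%E.
  by rewrite /patch; case: ifPn => // /[!inE] /fg.
rewrite /integral; apply: leeB.
- apply: ge_ereal_sup => _ [h /= hf <-]; apply: ereal_sup_ubound; exists h => // x.
  apply: (le_trans (hf x)); rewrite !funeposE ge_max !le_max lexx orbT andbT.
  by rewrite le_restrict.
- apply: ge_ereal_sup => _ [h /= hf <-]; apply: ereal_sup_ubound; exists h => // x.
  apply: (le_trans (hf x)); rewrite !funenegE ge_max !le_max lexx orbT andbT.
  by rewrite leeN2 le_restrict.
Qed.

(** Both sides behave like y^2 near 0, and the exponential only sees how far y
    can go to the left. This is how the rate exp(2 z c) enters the estimates. *)
Lemma sqr_expRB1_le (R : realType) (z y c : R) : 0 <= z -> 0 < c -> - c <= y ->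
  (expR (- (z * y)) - 1) ^+ 2 <=
  (1 + z ^+ 2) * expR (2 * z * c) * Num.min (y ^+ 2) 1.
Proof.
move=> z0 c0 cy.
have E1 : 1 <= expR (z * c) by rewrite -expR0 ler_expR mulr_ge0 ?(ltW c0).
have -> : expR (2 * z * c) = expR (z * c) ^+ 2 by rewrite -expRM_natl -mulrA.
set E := expR (z * c) in E1 *.
have le1 : `|expR (- (z * y)) - 1| <= E.
  have [zy|zy] := leP (expR (- (z * y))) 1.
    have := expR_gt0 (- (z * y)); rewrite ler_norml; lra.
  rewrite ger0_norm ?subr_ge0 ?(ltW zy)//.
  have : expR (- (z * y)) <= E by rewrite ler_expR; nra.
  lra.
have le2 : `|expR (- (z * y)) - 1| <= z * `|y| * E.
  have h := expR_ge1Dx (- (z * y)); have h' := expR_ge1Dx (z * y).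
  have [y0|y0] := leP 0 y.
    rewrite (ger0_norm y0) ler0_norm; last by rewrite subr_le0 -expR0 ler_expR oppr_le0 mulr_ge0.
    have : 0 <= z * y by rewrite mulr_ge0.
    nra.
  rewrite (ltr0_norm y0) ger0_norm; last by rewrite subr_ge0 -expR0 ler_expR; nra.
  have -> : expR (- (z * y)) - 1 = expR (- (z * y)) * (1 - expR (z * y)).
    by rewrite mulrBr mulr1 -expRD addNr expR0.
  have h3 : expR (- (z * y)) <= E by rewrite ler_expR; nra.
  have := expR_gt0 (- (z * y)).
  have : 0 <= z * - y by nra.
  nra.
rewrite -[leLHS]real_normK ?num_real//.
have nn := normr_ge0 (expR (- (z * y)) - 1).
have [y1|y1] := leP (y ^+ 2) 1.
- apply: (@le_trans _ _ ((z * `|y| * E) ^+ 2)); first by rewrite ler_pXn2r ?nnegrE// (le_trans nn).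
  rewrite !exprMn real_normK ?num_real// -mulrA [y ^+2 * _]mulrC mulrA.
  rewrite ler_wpM2r ?sqr_ge0// ler_wpM2r ?sqr_ge0//; lra.
- rewrite mulr1 (@le_trans _ _ (E ^+ 2))//; first by rewrite ler_pXn2r ?nnegrE// (le_trans nn).
  by rewrite ler_peMl ?sqr_ge0// lerDl sqr_ge0.
Qed.

Lemma expRN_compensated_le (R : realType) (w : R) :
  0 <= expR (- w) - 1 + w <= w * (1 - expR (- w)).
Proof.
have h1 := expR_ge1Dx (- w); have h2 := expR_ge1Dx w.
apply/andP; split; first lra.
have : expR (- w) * (1 + w) <= 1.
  by rewrite -[leRHS](expRxMexpNx_1 w) [leRHS]mulrC ler_pM2l ?expR_gt0.
lra.
Qed.

(** * Levy measures and their exponents *)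

(** The complement of the support is an open set all of whose points have a null
    neighbourhood; countably many rational intervals cover it. *)
Lemma negligible_setC_support (R : realType)
    (nu : {measure set (measurableTypeR R) -> \bar R}) :
  nu.-negligible (~` measure_support nu).
Proof.
pose V (u : rat * rat) : set R := `]ratr u.1, ratr u.2[%classic.
pose N (n : nat) : set R :=
  if @choice.unpickle (rat * rat)%type n is Some u
  then (if (nu (V u) == 0)%E then V u else set0) else set0.
apply: (@negligibleS _ _ _ nu (\bigcup_n N n)); last first.
  apply: negligible_bigcup => k; rewrite /N.
  case: choice.unpickle => [u|]; last exact: negligible_set0.
  case: ifPn => [/eqP nuV|_]; last exact: negligible_set0.
  by exists (V u); split => //; exact: measurable_itv.
move=> y /existsNP[U /not_implyP[oU /not_implyP[Uy nuU]]].
have {}nuU : nu U = 0%E.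
  by apply/eqP; rewrite eq_le measure_ge0 andbT leNgt; apply/negP.
have /nbhs_ballP[e /= e0 eU] : nbhs y U by exact: open_nbhs_nbhs.
have [p p_itv] : exists p : rat, ratr p \in `]y - e, y[.
  by apply: rat_in_itvoo; rewrite ltrBlDr ltrDl.
have [q q_itv] : exists q : rat, ratr q \in `]y, y + e[.
  by apply: rat_in_itvoo; rewrite ltrDl.
move: p_itv q_itv; rewrite !in_itv/= => /andP[p1 p2] /andP[q1 q2].
exists (choice.pickle (p, q)); first exact: Logic.I.
rewrite /N choice.pickleK.
have VU : V (p, q) `<=` U.
  move=> x; rewrite /V /= in_itv/= => /andP[px xq]; apply: eU.
  by rewrite /ball/= ltr_distlC; apply/andP; split; [exact: lt_trans px|exact: lt_trans xq _].
have -> : nu (V (p, q)) = 0%E.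
  apply/eqP; rewrite -measure_le0 -nuU le_measure// inE; first exact: measurable_itv.
  exact: open_measurable.
by rewrite eqxx /V /= in_itv/= p2 q1.
Qed.

(** The support is closed, so that - k lies at a positive distance from it: the
    measure gives no mass up to a point - c strictly above - k. *)
Lemma measure0_below_support (R : realType)
    (nu : {measure set (measurableTypeR R) -> \bar R}) (k : R) : 0 < k ->
  measure_support nu `<=` [set y | - k < y] ->
  exists2 c, 0 < c < k & nu `]-oo, - c]%classic = 0%E.
Proof.
move=> k0 suppk.
have /existsNP[U /not_implyP[oU /not_implyP[Uk nuU]]] : ~ measure_support nu (- k).
  by move=> /suppk /=; rewrite ltxx.
have {}nuU : nu U = 0%E.
  by apply/eqP; rewrite eq_le measure_ge0 andbT leNgt; apply/negP.
have /nbhs_ballP[e /= e0 eU] : nbhs (- k) U by exact: open_nbhs_nbhs.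
have e'0 : 0 < Num.min (e / 2) (k / 2) by rewrite lt_min !divr_gt0.
have e'e : Num.min (e / 2) (k / 2) < e by rewrite gt_min; apply/orP; left; lra.
have e'k : Num.min (e / 2) (k / 2) < k by rewrite gt_min; apply/orP; right; lra.
exists (k - Num.min (e / 2) (k / 2)); first by lra.
apply/negligibleP; first exact: measurable_itv.
apply: (@negligibleS _ _ _ nu (~` measure_support nu `|` U)); last first.
  apply: negligibleU; first exact: negligible_setC_support.
  by exists U; split => //; exact: open_measurable.
move=> y; rewrite /= in_itv/= => ye.
have [yk|yk] := leP y (- k).
  by left => /suppk /=; lra.
by right; apply: eU; rewrite /ball/= ltr_distlC; lra.
Qed.

Section LevyExponent.
Context (R : realType) (a q : R) (nu : {measure set (measurableTypeR R) -> \bar R}).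
Hypothesis nu_levy : is_levy_measure nu.
Variable c : R.
Hypothesis c_gt0 : 0 < c.
Hypothesis nu_below : nu `]-oo, - c]%classic = 0%E.

Let compensated (z y : R) : R :=
  expR (- (z * y)) - 1 + z * y * \1_(`]-1, 1[ : set R) y.

Let trunc (y : R) : R := Num.min (y ^+ 2) 1.

Let K (z : R) : R := (1 + z ^+ 2) * expR (2 * z * c).

Let measurable_exp (z : R) :
  measurable_fun setT (fun y : measurableTypeR R => expR (- (z * y))).
Proof.
by apply: measurableT_comp => //; apply: measurableT_comp => //; exact: measurable_funM.
Qed.

Let measurable_trunc : measurable_fun setT (trunc : measurableTypeR R -> R).
Proof. by apply: measurable_minr => //; exact: measurable_funX. Qed.

Let measurable_compensated (z : R) :
  measurable_fun setT (compensated z : measurableTypeR R -> R).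
Proof.
apply: measurable_funD; first exact: measurable_funB.
by apply: measurable_funM => //; apply: measurable_indic; exact: measurable_itv.
Qed.

Let trunc_ge0 y : 0 <= trunc y.
Proof. by rewrite le_min sqr_ge0 ler01. Qed.

Let integrable_trunc : nu.-integrable setT (EFin \o trunc).
Proof.
apply/integrableP; split; first exact/measurable_EFinP.
under eq_integral => y _ do rewrite /= (ger0_norm (trunc_ge0 y)).
by case: nu_levy.
Qed.

Let ae_above : {ae nu, forall y : measurableTypeR R, - c <= y}.
Proof.
exists `]-oo, - c]%classic; split => //.
by move=> y /= /negP; rewrite -ltNge in_itv/= => /ltW.
Qed.

Let integrable_cMtrunc (k : R) : nu.-integrable setT (EFin \o (fun y => k * trunc y)).
Proof.
under [X in _.-integrable _ X]funext do rewrite /= EFinM.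
exact: integrableZl.
Qed.

Let integral_cMtrunc_lty (k : R) : 0 <= k -> (\int[nu]_y (k * trunc y)%:E < +oo)%E.
Proof.
move=> k0; have /integrableP[_] := integrable_cMtrunc k.
by under eq_integral => y _ do rewrite /= ger0_norm ?mulr_ge0//.
Qed.

Let integrable_le_trunc (f : measurableTypeR R -> R) (C : R) :
  measurable_fun setT f -> (forall y, - c <= y -> `|f y| <= C * trunc y) ->
  nu.-integrable setT (EFin \o f).
Proof.
move=> mf fC; apply/integrableP; split; first exact/measurable_EFinP.
apply: (@le_lt_trans _ _ (\int[nu]_y `|(C * trunc y)%:E|)%E); last first.
  by have /integrableP[_] := integrable_cMtrunc C.
apply: ae_ge0_le_integral => //.
- by do 2 apply: measurableT_comp => //.
- by apply: measurableT_comp => //; apply/measurable_EFinP; exact: measurable_funM.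
- move: ae_above; apply: filterS => y cy _ /=.
  by rewrite lee_fin (le_trans (fC _ cy))// ler_norm.
Qed.

Lemma exp_moment_finite (z : R) : 0 <= z ->
  (\int[nu]_(y in [set y : R | (1 <= `|y|)%R]) (expR (- (z * y)))%:E < +oo)%E.
Proof.
move=> z0.
have mD : measurable ([set y : R | 1 <= `|y|] : set (measurableTypeR R)).
  rewrite (_ : [set _ | _] = ~` `]-1, 1[%classic).
    by apply: measurableC; exact: measurable_itv.
  apply/seteqP; split=> y /=; rewrite in_itv/= -ltr_norml.
    by move=> h; apply/negP; rewrite -leNgt.
  by move=> /negP; rewrite -leNgt.
apply: le_lt_trans (integral_cMtrunc_lty (expR_ge0 (z * c))).
rewrite integral_mkcond.
apply: (@ae_ge0_le_integral _ (measurableTypeR R) R nu setT measurableT).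
- by move=> y _; rewrite /patch; case: ifPn => // _; rewrite lee_fin expR_ge0.
- apply/(measurable_restrictT _ mD).
  by apply/measurable_EFinP; apply: measurable_funS (measurable_exp z).
- by move=> y _; rewrite lee_fin mulr_ge0 ?expR_ge0.
- by apply/measurable_EFinP; exact: measurable_funM.
- move: ae_above; apply: filterS => y cy _ /=.
  rewrite /patch; case: ifPn => [|_]; last by rewrite lee_fin mulr_ge0 ?expR_ge0.
  rewrite inE/= => y1; rewrite lee_fin.
  have -> : trunc y = 1.
    by apply/min_idPr; rewrite -[leRHS]real_normK ?num_real// expr_ge1.
  by rewrite mulr1 ler_expR; nra.
Qed.

Let compensated_le_trunc (z y : R) : 0 <= z -> - c <= y ->
  `|compensated z y| <= (1 + z ^+ 2 + K z) * trunc y.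
Proof.
move=> z0 cy; have hK := sqr_expRB1_le z0 c_gt0 cy.
rewrite -/(K z) -/(trunc y) in hK.
have K0 : 0 <= K z by rewrite mulr_ge0 ?expR_ge0// addr_ge0 ?sqr_ge0.
have t0 := trunc_ge0 y.
rewrite /compensated indicE; case: (boolP (y \in _)) => [|].
  rewrite inE/= in_itv/= => y1; rewrite mulr1.
  have /andP[h1 h2] := expRN_compensated_le (z * y).
  have t2 : trunc y = y ^+ 2.
    by apply/min_idPl; rewrite -[leLHS]real_normK ?num_real// exprn_ile1// ler_norml; lra.
  rewrite ger0_norm//; move: hK h2; rewrite t2; set e := expR _ => hK h2.
  have := sqr_ge0 (z * y + (e - 1)); have := sqr_ge0 y; rewrite !expr2.
  nra.
rewrite notin_setE/= in_itv/= => /negP y1; rewrite mulr0 addr0.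
have -> : trunc y = 1.
  apply/min_idPr; rewrite -[leRHS]real_normK ?num_real// expr_ge1//.
  by rewrite leNgt ltr_norml.
have t1 : trunc y <= 1 by rewrite ge_min lexx orbT.
have hK1 : (expR (- (z * y)) - 1) ^+ 2 <= K z by nra.
rewrite mulr1; have := sqr_ge0 (`|expR (- (z * y)) - 1| - 1).
have := sqr_ge0 z; have := normr_ge0 (expR (- (z * y)) - 1).
have : `|expR (- (z * y)) - 1| ^+ 2 = (expR (- (z * y)) - 1) ^+ 2 by rewrite real_normK ?num_real.
rewrite sqrrB1; nra.
Qed.

Lemma integrable_compensated (z : R) : 0 <= z ->
  nu.-integrable setT (EFin \o compensated z).
Proof.
by move=> z0; apply: (integrable_le_trunc (measurable_compensated z)) => y;
  exact: compensated_le_trunc.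
Qed.

(** In J(2z) - 2 J(z) the terms linear in z cancel, and what remains of the
    integrand is the square (exp(-z y) - 1)^2. *)
Lemma levy_exponent_variance_le (z : R) : 0 <= z ->
  levy_exponent a q nu (2 * z) - 2 * levy_exponent a q nu z <=
  q * z ^+ 2 + (1 + z ^+ 2) * expR (2 * z * c) * (\int[nu]_y Num.min (y ^+ 2) 1).
Proof.
move=> z0; rewrite /levy_exponent.
have z20 : 0 <= 2 * z by rewrite mulr_ge0.
have K0 : 0 <= K z by rewrite mulr_ge0 ?expR_ge0// addr_ge0 ?sqr_ge0.
have msq : measurable_fun setT (fun y : measurableTypeR R => (expR (- (z * y)) - 1) ^+ 2).
  by apply: measurable_funX; exact: measurable_funB.
have intsq : nu.-integrable setT
    (EFin \o (fun y : measurableTypeR R => (expR (- (z * y)) - 1) ^+ 2)).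
  apply: (@integrable_le_trunc _ (K z)) => // y cy.
  by rewrite ger0_norm ?sqr_ge0//; exact: sqr_expRB1_le.
have -> : \int[nu]_y compensated (2 * z) y =
    \int[nu]_y (expR (- (z * y)) - 1) ^+ 2 + 2 * \int[nu]_y compensated z y.
  rewrite -RintegralZl//; last exact: integrable_compensated.
  rewrite -RintegralD//.
  - apply: eq_Rintegral => y _; rewrite /compensated.
    rewrite -[2 * z * y]mulrA -mulrN expRM_natl; ring.
  - under [X in _.-integrable _ X]funext do rewrite /= EFinM.
    by apply: integrableZl => //; exact: integrable_compensated.
have : \int[nu]_y (expR (- (z * y)) - 1) ^+ 2 <= K z * \int[nu]_y trunc y.
  rewrite -RintegralZl// /Rintegral fine_le ?(integrable_fin_num _ (integrable_cMtrunc _))//.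
    exact: integrable_fin_num.
  apply: ae_ge0_le_integral => //.
  - by move=> y _; rewrite lee_fin sqr_ge0.
  - exact/measurable_EFinP.
  - by move=> y _; rewrite lee_fin mulr_ge0.
  - by apply/measurable_EFinP; exact: measurable_funM.
  - move: ae_above; apply: filterS => y cy _ /=.
    by rewrite lee_fin; exact: sqr_expRB1_le.
rewrite -[X in _ <= X * _ -> _]/((1 + z ^+ 2) * expR (2 * z * c)) /trunc.
rewrite -[\int[nu]_y (_ + _ * _)]/(\int[nu]_y compensated z y) => hsq.
rewrite exprMn; move: hsq.
move: (\int[nu]_y _ ^+ 2) (\int[nu]_y compensated z y) (_ * expR _ * _) => A B D; lra.
Qed.

Hypothesis q_ge0 : 0 <= q.
Hypothesis mean_large_jumps : (\int[nu]_(y in `[1%R, +oo[) y%:E < +oo)%E.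

Let large (y : R) : R := y * \1_(`[1, +oo[ : set R) y.

Let integrable_large : nu.-integrable setT (EFin \o (large : measurableTypeR R -> R)).
Proof.
have mlarge : measurable_fun setT (large : measurableTypeR R -> R).
  by apply: measurable_funM => //; apply: measurable_indic; exact: measurable_itv.
apply/integrableP; split; first exact/measurable_EFinP.
apply: le_lt_trans mean_large_jumps; rewrite [leRHS]integral_mkcond.
apply: le_integral_monotone => y _; rewrite /= /large indicE /patch.
case: ifPn => [|_]; last by rewrite /= mulr0 normr0.
by rewrite inE/= in_itv/= andbT mulr1 => y1; rewrite lee_fin ger0_norm// (le_trans ler01).
Qed.

(** Each integrand is convex in z with slope y (1_(|y| < 1) - exp(-z y)), which is
    nonnegative except when y >= 1, where it is at least - y. *)
Lemma levy_exponent_increment_ge (z h : R) : 0 <= z -> 0 <= h ->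
  - (`|a| + \int[nu]_y large y) * h <=
  levy_exponent a q nu (z + h) - levy_exponent a q nu z.
Proof.
move=> z0 h0.
have zh0 : 0 <= z + h by rewrite addr_ge0.
have : - h * \int[nu]_y large y <=
    \int[nu]_y compensated (z + h) y - \int[nu]_y compensated z y.
  rewrite -RintegralZl// -RintegralB//; try exact: integrable_compensated.
  apply: le_Rintegral => //.
  - under [X in _.-integrable _ X]funext do rewrite /= EFinM.
    exact: integrableZl.
  - under [X in _.-integrable _ X]funext do rewrite /= EFinB.
    by apply: integrableB => //; exact: integrable_compensated.
  - move=> y _; rewrite /large /compensated.
    have -> : expR (- ((z + h) * y)) = expR (- (z * y)) * expR (- (h * y)).
      by rewrite mulrDl opprD expRD.
    have e0 := expR_gt0 (- (z * y)); have e1 := expR_ge1Dx (- (h * y)).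
    have key : - (h * y) * expR (- (z * y)) <=
        expR (- (z * y)) * expR (- (h * y)) - expR (- (z * y)) by nra.
    rewrite !indicE; case: (boolP (y \in (`]-1, 1[%classic : set R))) => [|].
      rewrite inE/= in_itv/= => y1.
      have -> : (y \in (`[1, +oo[%classic : set R)) = false.
        by apply/negbTE; rewrite notin_setE/= in_itv/= andbT; lra.
      rewrite !mulr1 !mulr0/=.
      suff : 0 <= h * (y * (1 - expR (- (z * y)))) by nra.
      rewrite mulr_ge0//; have [y0|y0] := leP 0 y.
        by rewrite mulr_ge0// subr_ge0 expR_le1 oppr_le0 mulr_ge0.
      by rewrite nmulr_rge0// subr_le0 -expR0 ler_expR; nra.
    rewrite notin_setE/= in_itv/= => /negP; rewrite negb_and -!leNgt => y1.
    rewrite !mulr0 !addr0/=; have [yl|yl] := leP 1 y.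
      have -> : (y \in (`[1, +oo[%classic : set R)) = true by rewrite mem_setE in_itv/= yl.
      rewrite mulr1; suff e_le1 : expR (- (z * y)) <= 1.
        have : 0 <= h * y * (1 - expR (- (z * y))).
          by rewrite !mulr_ge0 ?subr_ge0 ?(le_trans _ yl).
        lra.
      by rewrite expR_le1; nra.
    have -> : (y \in (`[1, +oo[%classic : set R)) = false.
      by apply/negbTE; rewrite mem_setE in_itv/= andbT -ltNge.
    have {}y1 : y <= -1 by case/orP: y1 => y1; lra.
    have : 0 <= h * - y by nra.
    rewrite mulr0 mulr0; nra.
rewrite /levy_exponent.
rewrite -[\int[nu]_y (_ - _ + (z + h) * _ * _)]/(\int[nu]_y compensated (z + h) y).
rewrite -[\int[nu]_y (_ - _ + z * _ * _)]/(\int[nu]_y compensated z y).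
move: (\int[nu]_y compensated _ y) (\int[nu]_y compensated z y) (\int[nu]_y large y).
move=> A B D hAB.
have := ler_norm a; have : 0 <= q * (2 * z * h + h ^+ 2).
  by rewrite mulr_ge0// addr_ge0 ?sqr_ge0// !mulr_ge0.
rewrite sqrrD; nra.
Qed.

(** Every difference quotient on the half-line is bounded below by the previous
    lemma, hence so is its limit. A limit that fails to exist has the default
    value [point], which the constant C takes into account. *)
Lemma levy_exponent_deriv_bounded_below :
  exists2 C : R, 0 <= C & forall z, 0 <= z -> - C <= levy_exponent_deriv a q nu z.
Proof.
set C := `|a| + \int[nu]_y large y.
have C0 : 0 <= C.
  apply: addr_ge0 => //; apply: Rintegral_ge0 => y _; rewrite /large indicE.
  case: (boolP (y \in _)); last by rewrite mulr0.
  by rewrite mem_setE in_itv/= andbT mulr1 => /(le_trans ler01).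
exists (Num.max C `|point : R|); first by rewrite le_max C0.
move=> z z0; rewrite /levy_exponent_deriv.
have lim_ge (F : set_system R) : ProperFilter F -> forall f : R -> R,
    (\forall h \near F, - C <= f h) -> - Num.max C `|point : R| <= lim (f @ F).
  move=> FF f fC; have [cf|/dvgP->] := pselect (cvg (f @ F)).
    apply: limr_ge => //; apply: filterS fC => h; apply: le_trans.
    by rewrite lerN2 le_max lexx.
  by rewrite lerNl (le_trans (ler_norm _))// normrN le_max lexx orbT.
case: ifPn => [zgt|zle].
  rewrite /derive1; apply: lim_ge.
  near=> h.
  have h0 : h != 0 by near: h; exact: nbhs_dnbhs_neq.
  have hz : `|h| < z.
    near: h; apply: dnbhs0_lt => //.
  rewrite /GRing.scale/= mulrC; case: (ltgtP h 0) h0 => // hs _.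
    rewrite -mulrNN -invrN -ler_pdivrMr ?invr_gt0 ?oppr_gt0// invrK opprB.
    have := @levy_exponent_increment_ge (h + z) (- h).
    rewrite [h + z + - h]addrAC subrr add0r; apply; last lra.
    by rewrite ltr0_norm// in hz; lra.
  rewrite ler_pdivlMr// [h + z]addrC; apply: levy_exponent_increment_ge; lra.
apply: lim_ge; near=> h.
have h0 : 0 < h by near: h; exact: nbhs_right_gt.
by rewrite ler_pdivlMr//; apply: levy_exponent_increment_ge; rewrite // ltW.
Unshelve. all: by end_near. Qed.

End LevyExponent.

(** * Jumps of cadlag paths and increments along a grid *)

Lemma le_limn_einf_cvg (R : realType) (u v : R^nat) (l : R) :
  u @ \oo --> l -> (\forall n \near \oo, u n <= v n) ->
  (l%:E <= limn_einf (fun n => (v n)%:E))%E.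
Proof.
move=> ul uv; apply/lee_addgt0Pr => e e0.
rewrite -leeBlDr//= limn_einf_lim; apply: lime_ge; first exact: is_cvg_einfs.
have ul' : \forall n \near \oo, l - e <= u n.
  have : \forall n \near \oo, `|l - u n| < e by move/cvgrPdist_lt : ul; exact.
  by apply: filterS => n; rewrite ltr_norml => /andP[]; lra.
have [N _ HN] : \forall n \near \oo, (l - e <= v n)%R.
  by move: uv ul'; apply: filterS2 => n /[swap]; exact: le_trans.
exists N => //= n Nn; apply: le_ereal_inf_tmp => _ [m /= nm <-].
by rewrite lee_fin; apply: HN => /=; exact: leq_trans nm.
Qed.

Definition grid {R : realType} (T : R) (n i : nat) : R := T * i%:R / n.+1%:R.

Lemma grid_cell (R : realType) (T s : R) (n : nat) : 0 < s <= T ->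
  exists i : 'I_n.+1, grid T n i < s <= grid T n i.+1.
Proof.
move=> /andP[s0 sT]; have T0 : 0 < T := lt_le_trans s0 sT.
have grid_max : s <= grid T n n.+1 by rewrite /grid mulfK ?pnatr_eq0.
have ex : exists i, s <= grid T n i by exists n.+1.
case: (ex_minnP ex) => -[|i] si mini; first by move: si; rewrite /grid mulr0 mul0r leNgt s0.
have i_lt : (i < n.+1)%N by exact: mini.
exists (Ordinal i_lt); rewrite si andbT ltNge; apply/negP => /mini.
by rewrite ltnn.
Qed.

Lemma grid_step (R : realType) (T : R) (n i : nat) :
  grid T n i.+1 = grid T n i + T / n.+1%:R.
Proof. by rewrite /grid -natr1 mulrDr mulr1 mulrDl. Qed.

Section JumpsAndIncrements.
Context (R : realType) (f : R -> R) (T : R).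
Hypothesis f_cadlag : cadlag_on `[0, +oo[ f.

Let step_cvg0 : T / n.+1%:R @[n --> \oo] --> (0 : R).
Proof. by rewrite -[X in _ --> X](mulr0 T); apply: cvgM; [exact: cvg_cst|exact: cvg_harmonic]. Qed.

Let step_lt (e : R) : 0 < e -> \forall n \near \oo, T / n.+1%:R < e.
Proof.
move=> e0; move/cvgrPdist_lt : step_cvg0 => /(_ e e0).
by apply: filterS => n; rewrite sub0r normrN; apply: le_lt_trans; exact: ler_norm.
Qed.

(** The two ends of the cell ]u, v] containing s converge to s, u strictly from the
    left and v from the right, hence f v - f u converges to f s - f (s-). *)
Lemma increment_cvg_jump (s : R) (i : nat -> nat) : 0 < s ->
  (forall n, grid T n (i n) < s <= grid T n (i n).+1) ->
  f (grid T n (i n).+1) - f (grid T n (i n)) @[n --> \oo] --> jump f s.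
Proof.
move=> s0 is_; rewrite /jump s0.
have s_ge0 : (`[0, +oo[%classic : set R) s by rewrite /= in_itv/= andbT ltW.
have [fr fl] := f_cadlag s_ge0.
apply: cvgB.
- apply/cvgrPdist_lt => e e0.
  have := fr; move/cvgrPdist_lt => /(_ e e0); rewrite near_withinE.
  move=> [d /= d0 dP]; have := step_lt d0.
  apply: filterS => n Tn; have /andP[] := is_ n; rewrite grid_step.
  move: (grid T n (i n)) (T / n.+1%:R) Tn => g st gst h1.
   rewrite le_eqVlt => /predU1P[<-|h2]; first by rewrite subrr normr0.
  apply: dP => //=.
    by rewrite ltr0_norm; lra.
  by rewrite in_itv/= andbT; lra.
- have within_left : f u @[u --> s^'-] --> lim (f u @[u --> s^'-]).
    suff -> : s^'- = within `[0, +oo[ (s^'-) :> set_system R by [].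
    apply/seteqP; split => A; first by apply: filterS => u Au _.
    rewrite /within/= => sA; near=> u.
    have : `[0, +oo[%classic u -> A u by near: u.
    apply; rewrite /= in_itv/= andbT ltW//; near: u.
  apply: (cvg_comp _ _ _ within_left) => A [d /= d0 dP].
  have := step_lt d0; apply: filterS => n Tn; have /andP[] := is_ n.
  rewrite grid_step /=; move: (grid T n (i n)) (T / n.+1%:R) Tn => g st gst h1 h2.
  by apply: dP => //=; rewrite gtr0_norm; lra.
Unshelve. all: by end_near. Qed.

(** Once the mesh is below the distance between any two points of B, distinct
    points lie in distinct cells; the increments over these cells converge to the
    jumps, and the other cells contribute nonnegative terms. *)
Lemma sum_jumps_le_liminf (phi : R -> R) (B : seq R) : uniq B ->
  continuous phi -> (forall x, 0 <= phi x) -> (forall s, s \in B -> 0 < s <= T) ->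
  ((\sum_(s <- B) phi (jump f s))%:E <=
    limn_einf (fun n => (\sum_(i < n.+1)
      phi (f (grid T n i.+1) - f (grid T n i)))%:E))%E.
Proof.
move=> uB cphi phi0 B0T.
have [i iP] : exists i : R -> forall n, 'I_n.+1, forall s n, s \in B ->
    grid T n (i s n) < s <= grid T n (i s n).+1.
  have h (s : R) n : exists i : 'I_n.+1, s \in B -> grid T n i < s <= grid T n i.+1.
    have [sB|sB] := boolP (s \in B); last by exists ord0.
    by have [i] := grid_cell n (B0T _ sB); exists i.
  exists (fun s n => sval (cid (h s n))) => s n; exact: (svalP (cid (h s n))).
apply: (@le_limn_einf_cvg _ (fun n =>
   \sum_(s <- B) phi (f (grid T n (i s n).+1) - f (grid T n (i s n))))).
  rewrite big_seq; under eq_fun do rewrite big_seq.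
  apply: (@cvg_big R _ +%R 0) => [|s sB]; first exact: add_continuous.
  apply: continuous_cvg; first exact: cphi.
  by apply: increment_cvg_jump => [|n]; [have /andP[] := B0T s sB|exact: iP].
have inj : \forall n \near \oo, {in B &, injective (fun s => i s n)}.
  pose I := seq_sub B.
  have : \forall n \near \oo, forall u : I * I,
      ssval u.1 != ssval u.2 -> i (ssval u.1) n != i (ssval u.2) n.
    apply: filter_forall => -[s s'] /=.
    have [_|ss'] := eqVneq (ssval s) (ssval s'); first exact: nearW.
    have d0 : 0 < `|ssval s - ssval s'| by rewrite normr_gt0 subr_eq0.
    have := step_lt d0; apply: filterS => n nd _; apply/eqP => ii.
    have /andP[a1 a2] := iP _ n (ssvalP s); have /andP[b1 b2] := iP _ n (ssvalP s').
    move: nd; rewrite ltNge => /negP; apply; rewrite ler_norml.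
    rewrite -ii in b1 b2; rewrite grid_step in a2 b2; move: a1 a2 b1 b2.
    by move: (grid _ _ _) (T / _) => g t; lra.
  apply: filterS => n nP s s' sB s'B ii; apply/eqP; apply: contraT => ss'.
  by have := nP (SeqSub sB, SeqSub s'B) ss'; rewrite /= ii eqxx.
move: inj; apply: filterS => n inj.
rewrite -(big_map (fun s => i s n) predT
  (fun j : 'I_n.+1 => phi (f (grid T n j.+1) - f (grid T n j)))).
rewrite big_uniq/=; last by rewrite map_inj_in_uniq.
rewrite [leRHS](bigID (mem (map (fun s => i s n) B)))/= lerDl.
by apply: sumr_ge0.
Qed.
End JumpsAndIncrements.

Lemma limn_einf_le_cvg (R : realType) (u : R^nat) (v : (\bar R)^nat) (l : R) :
  u @ \oo --> l -> (\forall n \near \oo, (v n <= (u n)%:E)%E) ->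
  (limn_einf v <= l%:E)%E.
Proof.
move=> ul vu; apply/lee_addgt0Pr => e e0; rewrite -EFinD.
rewrite limn_einf_lim; apply: lime_le; first exact: is_cvg_einfs.
have ul' : \forall n \near \oo, u n <= l + e.
  have : \forall n \near \oo, `|l - u n| < e by move/cvgrPdist_lt : ul; exact.
  by apply: filterS => n; rewrite ltr_norml => /andP[]; lra.
have [N _ HN] : \forall n \near \oo, (v n <= (l + e)%:E)%E.
  move: vu ul'; apply: filterS2 => n vn un.
  by rewrite (le_trans vn)// lee_fin.
near=> n; apply: (@le_trans _ _ (v (n + N)%N)); last by apply: HN => /=; exact: leq_addl.
by apply: ereal_inf_lbound; exists (n + N)%N => //=; exact: leq_addr.
Unshelve. all: by end_near. Qed.

Lemma expR_le_quadratic (R : realType) (x : R) : x <= 2^-1 ->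
  expR x <= 1 + x + 2 * x ^+ 2.
Proof.
move=> x2; have h := expR_ge1Dx (- x).
have e0 := expR_gt0 x; have hx : expR x * expR (- x) = 1 := expRxMexpNx_1 x.
have h1 : expR x * (1 - x) <= 1 by rewrite -[leRHS]hx ler_pM2l.
have h2 : 1 <= (1 + x + 2 * x ^+ 2) * (1 - x).
  have -> : (1 + x + 2 * x ^+ 2) * (1 - x) = 1 + x ^+ 2 * (1 - 2 * x) by ring.
  by rewrite lerDl mulr_ge0 ?sqr_ge0//; lra.
rewrite -(@ler_pM2r _ (1 - x)); last by lra.
exact: le_trans h2.
Qed.

(** * Jumps of a Levy process *)

Section LevyJumps.
Context d (T : measurableType d) (R : realType) (P : probability T R).
Context (F : R -> set (set T)) (L : R -> T -> R).
Hypothesis F_filtration : is_filtration F.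
Hypothesis L_levy : is_levy_process P F L.
Variable J : R -> R.
Hypothesis L_laplace : forall z t : R, 0 <= z -> 0 <= t ->
  ('E_P[fun w => expR (- (z * L t w))] = (expR (t * J z))%:E)%E.

(** The mean of phi z (L t) is a combination of Laplace transforms, and is of order
    t since phi z vanishes to second order at 0. *)
Let phi (z x : R) : R := (expR (- (z * x)) - 1) ^+ 2.

Let phi_ge0 z x : 0 <= phi z x. Proof. exact: sqr_ge0. Qed.

Let continuous_phi z : continuous (phi z).
Proof.
move=> x; apply: (@continuous_comp _ _ _ (fun y => expR (- (z * y)) - 1) (fun y => y ^+ 2)).
  2: exact: exprn_continuous.
apply: continuousB; last exact: cvg_cst.
apply: (@continuous_comp _ _ _ (fun y => - (z * y)) expR); last exact: continuous_expR.
by apply: continuousN; apply: continuousM; [exact: cvg_cst|exact: cvg_id].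
Qed.

Let measurable_phi z : measurable_fun setT (phi z).
Proof. exact: continuous_measurable_fun. Qed.

Let measurable_L (t : R) : 0 <= t -> measurable_fun setT (L t).
Proof.
move=> t0 _ B mB; rewrite setTI.
have [_ mF _] := F_filtration; apply: (mF t t0).
by apply: (levy_adapted L_levy) => //; rewrite /= in_itv/= andbT.
Qed.

Let phi_mean_stationary (z s t : R) : 0 <= s -> s <= t ->
  (\int[P]_w (phi z (L t w - L s w))%:E = \int[P]_w (phi z (L (t - s) w))%:E)%E.
Proof.
move=> s0 st; have t0 := le_trans s0 st.
have ts0 : 0 <= t - s by rewrite subr_ge0.
have mLts := measurable_L ts0.
have mD : measurable_fun setT (fun w => L t w - L s w).
  by apply: measurable_funB; exact: measurable_L.
have mphi : measurable_fun setT (EFin \o phi z) by exact/measurable_EFinP.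
have phi0 : {in [set: R], forall y, (0 <= (EFin \o phi z) y)%E}.
  by move=> y _; rewrite lee_fin.
rewrite -[LHS](ge0_integral_pushforward mD P measurableT mphi phi0).
rewrite -[RHS](ge0_integral_pushforward mLts P measurableT mphi phi0).
apply: eq_measure_integral => A mA _.
exact: (levy_stationary L_levy s0 st mA).
Qed.

Let phi_mean (z t : R) : 0 <= z -> 0 <= t ->
  (\int[P]_w (phi z (L t w))%:E =
   (expR (t * J (2 * z)) - 2 * expR (t * J z) + 1)%:E)%E.
Proof.
move=> z0 t0.
pose e (u : R) (w : T) := expR (- (u * L t w)).
have me u : measurable_fun setT (e u).
  apply: measurableT_comp => //; apply: measurableT_comp => //.
  by apply: measurable_funM => //; exact: measurable_L.
have Ee u : 0 <= u -> (\int[P]_w (e u w)%:E = (expR (t * J u))%:E)%E.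
  by move=> u0; rewrite -L_laplace// unlock.
have inte u : 0 <= u -> P.-integrable setT (EFin \o e u).
  move=> u0; apply/integrableP; split; first exact/measurable_EFinP.
  under eq_integral => w _ do rewrite /= ger0_norm ?expR_ge0//.
  by rewrite Ee// ltry.
have z20 : 0 <= 2 * z by rewrite mulr_ge0.
rewrite (_ : (fun w => _) = (fun w => (e (2 * z) w)%:E - 2%:E * (e z w)%:E + 1%:E)%E); last first.
  apply/funext => w; rewrite -EFinM -EFinB -EFinD; congr EFin.
  by rewrite /phi /e -[2 * z * L t w]mulrA -[- (2 * _)]mulrN expRM_natl; ring.
have i1 : P.-integrable setT (fun w => (2%:E * (e z w)%:E)%E).
  by apply: integrableZl => //; exact: inte.
have i2 := integrableB measurableT (inte _ z20) i1.
rewrite (integralD measurableT i2 (finite_measure_integrable_cst P 1 measurableT)).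
rewrite (integralB measurableT (inte _ z20) i1).
rewrite integralZl//; last exact: inte.
rewrite -[X in (_ + X)%E]/(\int[P]_w cst 1%:E w)%E integral_cst//.
rewrite [X in (_ + _ * X)%E](_ : _ = 1%E); last exact: probability_setT.
rewrite mule1.
by rewrite !Ee.
Qed.

Variable (Tmax : R).
Hypothesis Tmax_gt0 : 0 < Tmax.

Let increment_sum (z : R) (n : nat) (w : T) : R :=
  \sum_(i < n.+1) phi z (L (grid Tmax n i.+1) w - L (grid Tmax n i) w).

Let grid_ge0 n i : 0 <= grid Tmax n i.
Proof. by rewrite /grid divr_ge0// mulr_ge0// ltW. Qed.

Let measurable_increment_sum z n : measurable_fun setT (EFin \o increment_sum z n).
Proof.
apply/measurable_EFinP; apply: measurable_sum => i.
apply: measurableT_comp => //; apply: measurable_funB; exact: measurable_L.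
Qed.

Let increment_sum_ge0 z n w : 0 <= increment_sum z n w.
Proof. exact: sumr_ge0. Qed.

Let rate (z : R) : R := J (2 * z) - 2 * J z.

(** The first-order terms of the two exponentials sum up to Tmax * rate z; the
    second-order remainders are n + 1 terms of order 1 / (n + 1)^2. *)
Let increment_sum_mean_le (z : R) (n : nat) : 0 <= z ->
  2 * (Tmax * `|J (2 * z)|) <= n.+1%:R ->
  (\int[P]_w (increment_sum z n w)%:E <=
   (Tmax * rate z + 2 * (Tmax * J (2 * z)) ^+ 2 / n.+1%:R)%:E)%E.
Proof.
move=> z0 hn.
under eq_integral => w _ do rewrite /increment_sum -sumEFin.
rewrite ge0_integral_sum//; last first.
  - by move=> i w _; rewrite lee_fin.
  - move=> i; apply/measurable_EFinP; apply: measurableT_comp => //.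
    by apply: measurable_funB; exact: measurable_L.
set t := Tmax / n.+1%:R.
have t0 : 0 <= t by rewrite divr_ge0// ltW.
rewrite (eq_bigr (fun=> (expR (t * J (2 * z)) - 2 * expR (t * J z) + 1)%:E)); last first.
  move=> i _; rewrite phi_mean_stationary//; last by rewrite grid_step lerDl.
  by rewrite grid_step addrAC subrr add0r phi_mean.
rewrite sumEFin lee_fin sumr_const card_ord -[_ *+ _]mulr_natr.
have n0 : 0 < n.+1%:R :> R by rewrite ltr0n.
have tn : t * n.+1%:R = Tmax by rewrite mulfVK// gt_eqF.
have h1 : expR (t * J (2 * z)) <= 1 + t * J (2 * z) + 2 * (t * J (2 * z)) ^+ 2.
  apply: expR_le_quadratic; rewrite (le_trans (ler_norm _))// normrM (ger0_norm t0).
  rewrite /t mulrAC ler_pdivrMr//; lra.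
have h2 := expR_ge1Dx (t * J z).
have -> : Tmax * rate z + 2 * (Tmax * J (2 * z)) ^+ 2 / n.+1%:R =
   (t * J (2 * z) + 2 * (t * J (2 * z)) ^+ 2 - 2 * (t * J z)) * n.+1%:R.
  by rewrite -tn /rate; field; rewrite gt_eqF.
rewrite ler_pM2r//; lra.
Qed.

Let liminf_sum (z : R) (w : T) : \bar R := limn_einf (fun n => (increment_sum z n w)%:E).

Let measurable_liminf_sum z : measurable_fun setT (liminf_sum z).
Proof.
apply: measurableT_comp => //; apply: measurable_fun_limn_esup => n.
by apply: measurableT_comp => //; exact: measurable_increment_sum.
Qed.

Let liminf_sum_ge0 z w : (0 <= liminf_sum z w)%E.
Proof.
apply: (@le_limn_einf_cvg _ (fun=> 0)); first exact: cvg_cst.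
exact: nearW.
Qed.

Let liminf_sum_mean_le (z : R) : 0 <= z ->
  (\int[P]_w liminf_sum z w <= (Tmax * rate z)%:E)%E.
Proof.
move=> z0.
apply: (le_trans (fatou P measurableT (measurable_increment_sum z) _)).
  by move=> n w _; rewrite lee_fin.
pose u n : R := Tmax * rate z + 2 * (Tmax * J (2 * z)) ^+ 2 / n.+1%:R.
apply: (@limn_einf_le_cvg _ u).
  rewrite -[X in _ --> X]addr0; apply: cvgD; first exact: cvg_cst.
  rewrite -[X in _ --> X](mulr0 (2 * (Tmax * J (2 * z)) ^+ 2)).
  by apply: cvgM; [exact: cvg_cst|exact: cvg_harmonic].
near=> n; apply: increment_sum_mean_le => //.
apply: (@le_trans _ _ n%:R); last by rewrite ler_nat.
near: n; exact: nbhs_infty_ger.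
Unshelve. all: by end_near. Qed.

Let sum_jumps_le (z : R) (w : T) (B : seq R) : cadlag_on `[0, +oo[ (L ^~ w) ->
  uniq B -> (forall s, s \in B -> 0 < s <= Tmax) ->
  ((\sum_(s <- B) phi z (jump (L ^~ w) s))%:E <= liminf_sum z w)%E.
Proof. by move=> cL uB BT; exact: sum_jumps_le_liminf. Qed.

(** The lower limit of the sums over the increments is integrable, hence finite
    almost everywhere, and it dominates every finite sum over jumps. *)
Lemma ae_sum_jumps_bounded : {ae P, forall w, exists S : R, forall B : seq R,
  uniq B -> (forall s, s \in B -> 0 < s <= Tmax) ->
  \sum_(s <- B) (expR (- jump (L ^~ w) s) - 1) ^+ 2 <= S}.
Proof.
have : P.-integrable setT (liminf_sum 1).
  apply/integrableP; split => //.
  under eq_integral => w _ do rewrite gee0_abs//.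
  by apply: (le_lt_trans (liminf_sum_mean_le ler01)); rewrite ltry.
move=> /(integrable_ae measurableT); move: (levy_cadlag L_levy).
apply: filterS2 => w cL /(_ I) fin_w; exists (fine (liminf_sum 1 w)) => B uB BT.
rewrite -lee_fin fineK//; apply: le_trans (sum_jumps_le 1 cL uB BT).
by rewrite lee_fin; apply: ler_sum => s _; rewrite /phi mul1r.
Qed.

(** After division by exp(2 n c), the right-hand side still grows like
    exp(2 n (k - c)), hence at least like n^3. *)
Lemma exp_gap_beats_quadratic (C c k e : R) : c < k -> 0 < k -> 0 <= C -> 0 < e ->
  exists n : nat, 0 < phi n%:R (- k) /\
    C * (1 + n%:R ^+ 2) * expR (2 * n%:R * c) <= e * phi n%:R (- k).
Proof.
move=> ck k0 C0 e0; set dl := k - c; have dl0 : 0 < dl by rewrite subr_gt0.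
have [n n_ge] : exists n : nat, 1 + k^-1 + 8 * C / (e * dl ^+ 3) <= n%:R.
  exists (Num.bound (1 + k^-1 + 8 * C / (e * dl ^+ 3))).
  exact/ltW/unstable.ltr_bound.
have x0 : 0 <= 8 * C / (e * dl ^+ 3).
  by rewrite divr_ge0 ?mulr_ge0 ?exprn_ge0// ltW.
have k'0 : 0 < k^-1 by rewrite invr_gt0.
have n1 : 1 <= n%:R :> R by lra.
have nk : 1 <= n%:R * k by rewrite -ler_pdivrMr// mul1r; lra.
have nC : 8 * C <= n%:R * (e * dl ^+ 3).
  by rewrite -ler_pdivrMr ?mulr_gt0 ?exprn_gt0//; lra.
have E2 : 2 <= expR (n%:R * k) by apply: le_trans (expR_ge1Dx _); lra.
have phiE : phi n%:R (- k) = (expR (n%:R * k) - 1) ^+ 2 by rewrite /phi mulrN opprK.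
exists n; rewrite phiE; split; first by rewrite exprn_gt0//; lra.
have lev_ge : expR (n%:R * k) ^+ 2 / 4 <= (expR (n%:R * k) - 1) ^+ 2.
  by move: (expR _) E2 => E; nra.
have split_exp : expR (n%:R * k) ^+ 2 = expR (2 * n%:R * c) * expR (2 * n%:R * dl).
  by rewrite -expRM_natl -expRD; congr expR; rewrite /dl; ring.
have cubic : (n%:R * dl) ^+ 3 <= expR (2 * n%:R * dl).
  have nd0 : 0 <= n%:R * dl by rewrite mulr_ge0// ltW.
  have := @expR_ge1Dxn R (2 * n%:R * dl) 2.
  rewrite -mulrA mulr_ge0// => /(_ isT); rewrite exprMn.
  have -> : (3`!)%:R = 6 :> R by [].
  have : 0 <= (n%:R * dl) ^+ 3 by rewrite exprn_ge0.
  lra.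
apply: (@le_trans _ _ (e * (expR (n%:R * k) ^+ 2 / 4))); last by rewrite ler_pM2l.
rewrite split_exp; have c0 := expR_gt0 (2 * n%:R * c).
suff : C * (1 + n%:R ^+ 2) <= e * (expR (2 * n%:R * dl) / 4) by nra.
apply: (@le_trans _ _ (e * ((n%:R * dl) ^+ 3 / 4))); last by rewrite ler_pM2l//; lra.
have -> : e * ((n%:R * dl) ^+ 3 / 4) = n%:R ^+ 2 * (n%:R * (e * dl ^+ 3)) / 4 by ring.
have : 0 <= n%:R ^+ 2 * (n%:R * (e * dl ^+ 3) - 8 * C) by rewrite mulr_ge0 ?sqr_ge0// subr_ge0.
have : 0 <= C * (n%:R ^+ 2 - 1) by rewrite mulr_ge0// subr_ge0 expr_ge1.
lra.
Qed.

Variables (C c k : R).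
Hypothesis c_lt_k : c < k.
Hypothesis k_gt0 : 0 < k.
Hypothesis C_ge0 : 0 <= C.
Hypothesis rate_le : forall z : R, 0 <= z ->
  rate z <= C * (1 + z ^+ 2) * expR (2 * z * c).

(** A jump at or below - k makes the lower limit for z = n at least phi n (- k). By
    Markov this has probability at most Tmax * rate n / phi n (- k), which is
    arbitrarily small for suitable n. *)
Lemma ae_jumps_gt : {ae P, forall w, forall s, 0 < s <= Tmax ->
  - k < jump (L ^~ w) s}.
Proof.
pose A (n : nat) : set T := [set w | ((phi n%:R (- k))%:E <= `|liminf_sum n%:R w|)%E].
pose Bad : set T := \bigcap_n A n.
have mA n : measurable (A n).
  rewrite -[A n]setTI; apply: emeasurable_fun_c_infty => //.
  exact: measurableT_comp.
suff Bad0 : P.-negligible Bad.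
  have nBad : {ae P, forall w, ~ Bad w}.
    by move: Bad0; apply: negligibleS => w /= /contrapT.
  move: (levy_cadlag L_levy) nBad; apply: filterS2 => w cL nBad s s0T.
  rewrite ltNge; apply/negP => js; apply: nBad => n _.
  have sB u : u \in [:: s] -> 0 < u <= Tmax by rewrite inE => /eqP->.
  have := sum_jumps_le n%:R cL (erefl : uniq [:: s]) sB; rewrite big_seq1.
  rewrite /A /= gee0_abs//; apply: le_trans; rewrite lee_fin /phi mulrN opprK.
  have h1 : 1 <= expR (n%:R * k) by rewrite -expR0 ler_expR mulr_ge0// ltW.
  have h2 : expR (n%:R * k) <= expR (- (n%:R * jump (L ^~ w) s)).
    by rewrite ler_expR -mulrN ler_wpM2l// lerNr.
  by rewrite ler_pXn2r// ?nnegrE; lra.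
have mBad : measurable Bad by exact: bigcapT_measurable.
exists Bad; split => //; apply/eqP; rewrite eq_le measure_ge0 andbT.
apply/lee_addgt0Pr => e e0; rewrite add0e.
have TC0 : 0 <= Tmax * C by rewrite mulr_ge0// ltW.
have [n [lev0 lev_ge]] := exp_gap_beats_quadratic c_lt_k k_gt0 TC0 e0.
apply: (@le_trans _ _ (P (A n))).
  by apply: le_measure; rewrite ?inE// => w; apply.
have mono : {in `[0%E, +oo[%classic &, {homo (@id (\bar R)) : x y / (x <= y)%E}} by [].
have := @le_integral_comp_abse _ _ _ P _ measurableT _ _ id
  (@measurable_id _ _ _) (fun _ => id) mono
  (measurable_liminf_sum n%:R) lev0.
rewrite setTI -/(A n) => /le_trans markov.
have {}markov : ((phi n%:R (- k))%:E * P (A n) <= (phi n%:R (- k))%:E * e%:E)%E.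
  apply: markov; under eq_integral => w _ do rewrite gee0_abs//.
  apply: (le_trans (liminf_sum_mean_le _)); first by [].
  rewrite -EFinM lee_fin [leRHS]mulrC; apply: le_trans lev_ge.
  by rewrite -[Tmax * C * _]mulrA -[Tmax * _ * expR _]mulrA ler_pM2l// rate_le.
by move: markov; rewrite lee_pmul2l.
Qed.
End LevyJumps.

(** * Products of compensated jump factors *)

Section FiniteProducts.
Context (R : realType) (I : choiceType).
Implicit Types (B : seq I) (v x : I -> R).

Lemma ler_prod_subseq v B0 B : uniq B0 -> uniq B -> {subset B0 <= B} ->
  (forall s, s \in B -> 0 <= v s <= 1) ->
  \prod_(s <- B) v s <= \prod_(s <- B0) v s.
Proof.
move=> uB0 uB B0B v01.
rewrite (bigID (mem B0))/= -big_filter (perm_big B0)/=; last first.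
  apply: uniq_perm => //; first exact: filter_uniq.
  by move=> s; rewrite mem_filter; case: (boolP (s \in B0)) => //= /B0B.
rewrite ler_piMr//.
  by rewrite big_seq; apply: prodr_ge0 => s /B0B /v01 /andP[].
by rewrite big_seq_cond; apply: prodr_ile1 => s /andP[/v01].
Qed.

Lemma ler_1Bsum_prod v x B : (forall s, s \in B -> 0 <= v s <= 1) ->
  (forall s, s \in B -> 0 <= x s /\ 1 - x s <= v s) ->
  1 - \sum_(s <- B) x s <= \prod_(s <- B) v s.
Proof.
elim: B => [|s B IH] v01 xv; first by rewrite !big_nil subr0.
have {}IH : 1 - \sum_(j <- B) x j <= \prod_(j <- B) v j.
  by apply: IH => u uB; [apply: v01|apply: xv]; rewrite inE uB orbT.
rewrite !big_cons; have /andP[v0 v1] := v01 s (mem_head _ _).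
have [x0 vx] := xv s (mem_head _ _).
have p1 : \prod_(j <- B) v j <= 1.
  by rewrite big_seq; apply: prodr_ile1 => u uB; apply: v01; rewrite inE uB orbT.
have p0 : 0 <= \prod_(j <- B) v j.
  rewrite big_seq; apply: prodr_ge0 => u uB.
  by have /andP[] : 0 <= v u <= 1 by apply: v01; rewrite inE uB orbT.
nra.
Qed.
End FiniteProducts.

Section UnorderedProduct.
Context (R : realType) (A : set R) (v : R -> R) (p : R).
Hypothesis v01 : forall s, A s -> 0 <= v s <= 1.

Let prod_on (B : {fset R}) : R := \prod_(s <- B | s \in A) v s.

Let prod_on_antitone (B0 B : {fset R}) : (B0 `<=` B)%fset -> prod_on B <= prod_on B0.
Proof.
move=> /fsubsetP B0B; rewrite /prod_on -[leLHS]big_filter -[leRHS]big_filter.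
apply: ler_prod_subseq; rewrite ?filter_uniq ?fset_uniq//.
- by move=> s; rewrite !mem_filter => /andP[-> /B0B].
- by move=> s; rewrite mem_filter => /andP[/set_mem/v01].
Qed.

(** Factors in [0, 1] make the finite products antitone in the index set, so that
    they converge to their infimum: the limit defining the unordered product is a
    genuine one, not a default value. *)
Lemma unordered_prod_ge : (forall B : {fset R}, p <= \prod_(s <- B | s \in A) v s) ->
  p <= unordered_prod A v.
Proof.
move=> pB; rewrite /unordered_prod.
have FF : ProperFilter (@summability.totally R) := summability.totally_filter.
pose range : set R := [set prod_on B | B in [set: {fset R}]].
have inf_range : has_inf range.
  split; first by exists (prod_on fset0), fset0.
  by exists p => _ [B _ <-]; exact: pB.
have cv : prod_on B @[B --> @summability.totally R] --> inf range.
  apply/cvgrPdist_lt => e e0.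
  have [_ [B0 _ <-] B0e] := inf_adherent e0 inf_range.
  exists B0 => // B /= B0B.
  have h1 := prod_on_antitone B0B.
  have h2 : inf range <= prod_on B by apply: ge_inf; [exact: inf_range.2|exists B].
  by rewrite ler0_norm; lra.
apply: limr_ge; first by apply/cvg_ex; exists (inf range).
by exists fset0 => // B _; exact: pB.
Qed.
End UnorderedProduct.

Section StochasticExponentialFactors.
Context (R : realType).
Implicit Types (u x m l : R).

Let v u : R := (1 + u) * expR (- u).

Lemma compensated_factor_itv u : - 1 < u -> 0 <= v u <= 1.
Proof.
move=> u1; apply/andP; split; first by rewrite mulr_ge0 ?expR_ge0//; lra.
by rewrite /v -[leRHS](expRxMexpNx_1 u) ler_pM2r ?expR_gt0// expR_ge1Dx.
Qed.

Lemma compensated_factor_ge u : - 1 < u -> 1 - u ^+ 2 <= v u.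
Proof.
move=> u1; have := expR_ge1Dx (- u); rewrite /v.
have -> : 1 - u ^+ 2 = (1 + u) * (1 - u) by ring.
by rewrite ler_pM2l//; lra.
Qed.

(** A lower bound of v (l * x) that is uniform in l in [0, m]. *)
Let floor_factor m x : R := Num.min 1 (1 + m * x) * expR (- (m * `|x|)).

Let floor_factor_gt0 m x : - 1 < m * x -> 0 < floor_factor m x.
Proof. by move=> mx; rewrite mulr_gt0 ?expR_gt0// lt_min ltr01; lra. Qed.

Let floor_factor_le1 m x : 0 <= m -> - 1 < m * x -> floor_factor m x <= 1.
Proof.
move=> m0 mx; rewrite mulr_ile1 ?expR_ge0//.
- by rewrite le_min ler01; lra.
- by rewrite ge_min lexx.
- by rewrite expR_le1 oppr_le0 mulr_ge0.
Qed.

Let factor_ge_floor m l x : 0 <= l <= m -> - 1 < m * x -> floor_factor m x <= v (l * x).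
Proof.
move=> /andP[l0 lm] mx; apply: ler_pM; rewrite ?expR_ge0//.
- by rewrite le_min ler01; lra.
- rewrite ge_min; have [x0|x0] := leP 0 x.
    by rewrite lerDl mulr_ge0.
  by apply/orP; right; rewrite lerD2l; nra.
- rewrite ler_expR lerN2 (le_trans (ler_norm _))// normrM (ger0_norm l0).
  by rewrite ler_wpM2r.
Qed.

Lemma sqr_le_sqr_expRB1 x : (expR (- x) - 1) ^+ 2 <= 16^-1 ->
  x ^+ 2 <= 2 * (expR (- x) - 1) ^+ 2.
Proof.
move=> h; have h1 := expR_ge1Dx (- x); have h2 := expR_ge1Dx x.
have E0 := expR_gt0 (- x); have EE : expR x * expR (- x) = 1 := expRxMexpNx_1 x.
have h3 : (1 + x) * expR (- x) <= 1 by rewrite -[leRHS]EE ler_pM2r.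
move: (expR (- x)) h h1 h3 E0 => E h h1 h3 E0.
have E34 : 3 / 4 <= E by nra.
have [x0|x0] := leP 0 x; nra.
Qed.

(** Choose a finite set B0 that almost exhausts the sum of (exp(-D s) - 1)^2.
    Outside B0 the factors are at least 1 - (l s * D s)^2, and these squares sum
    up to at most 1/2; the finitely many factors in B0 are bounded below one by
    one. Both bounds are uniform in the weights l. *)
Lemma unordered_prod_compensated_bounded_below (D : R -> R) (m Tmax S : R) :
  0 < m -> (forall s, s <= 0 -> D s = 0) ->
  (forall s, 0 < s <= Tmax -> - m^-1 < D s) ->
  (forall B : seq R, uniq B -> (forall s, s \in B -> 0 < s <= Tmax) ->
    \sum_(s <- B) (expR (- D s) - 1) ^+ 2 <= S) ->
  exists2 p, 0 < p & forall (t : R) (l : R -> R), 0 <= t <= Tmax ->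
    (forall s, 0 <= s <= t -> 0 <= l s <= m) ->
    p <= unordered_prod `[0, t] (fun s =>
      let u := l s * D s in (1 + u) * expR (- u)).
Proof.
move=> m0 D0 D_gt sum_le.
pose ok (B : seq R) := uniq B /\ (forall s, s \in B -> 0 < s <= Tmax).
pose g s := (expR (- D s) - 1) ^+ 2.
pose sums : set R := [set \sum_(s <- B) g s | B in ok].
have sup_sums : has_sup sums.
  split; first by exists (\sum_(s <- [::]) g s), [::].
  by exists S => _ [B [uB B0T] <-]; exact: sum_le.
(* 1/16 allows the comparison of x^2 with (exp(-x) - 1)^2 up to a factor 2, and
   1/(4 m^2) then makes the squares (m * D s)^2 outside B0 sum up to at most 1/2. *)
pose e := Num.min 16^-1 (4 * m ^+ 2)^-1.
have e0 : 0 < e by rewrite lt_min !invr_gt0 mulr_gt0 ?exprn_gt0//; lra.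
have [_ [B0 [uB0 B0T] <-] B0e] := sup_adherent e0 sup_sums.
have mD s : 0 < s <= Tmax -> - 1 < m * D s.
  move=> /D_gt; rewrite -(ltr_pM2l m0) mulrN divff// gt_eqF//.
have tail B : ok B -> (forall s, s \in B -> s \notin B0) -> \sum_(s <- B) g s <= e.
  move=> [uB BT] BB0.
  have : \sum_(s <- B0 ++ B) g s <= sup sums.
    apply: ub_le_sup; first exact: sup_sums.2.
    exists (B0 ++ B) => //; split; last by move=> s; rewrite mem_cat => /orP[/B0T|/BT].
    rewrite cat_uniq uB0 uB andbT/=; apply/hasPn => s sB; exact: BB0.
  by rewrite big_cat/=; lra.
exists ((\prod_(s <- B0) floor_factor m (D s)) / 2).
  rewrite divr_gt0// big_seq; apply: prodr_gt0 => s /B0T /mD; exact: floor_factor_gt0.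
move=> t l /andP[t0 tT] lm.
have lD s : 0 <= s <= t -> - 1 < l s * D s.
  move=> st; have /andP[l0 lm'] := lm s st.
  have [s0|s0] := leP s 0; first by rewrite D0// mulr0; lra.
  have := mD s; rewrite s0 (le_trans _ tT); last by case/andP: st.
  by move=> /(_ isT); have [x0|x0] := leP 0 (D s); nra.
apply: unordered_prod_ge => [s|B].
  by rewrite /= in_itv/= => /lD; exact: compensated_factor_itv.
pose B' := [seq s <- B | 0 < s <= t].
have B'T s : s \in B' -> 0 < s <= Tmax.
  by rewrite mem_filter => /andP[/andP[-> st] _]; rewrite (le_trans st).
have B't s : s \in B' -> 0 <= s <= t.
  by rewrite mem_filter => /andP[/andP[s0 ->] _]; rewrite ltW.
have uB' : uniq B' by rewrite filter_uniq ?fset_uniq.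
(* s = 0 carries no jump, so that its factor is 1. *)
have -> : \prod_(s <- B | s \in `[0, t]%classic) v (l s * D s) =
    \prod_(s <- B') v (l s * D s).
  rewrite big_filter [LHS](bigID (fun s => 0 < s))/= mulrC big1 ?mul1r.
    apply: eq_bigl => s; rewrite mem_setE in_itv/=.
    by case: (ltP 0 s) => [s0|]; rewrite ?andbF// (ltW s0) andbT.
  move=> s /andP[_]; rewrite -leNgt => /D0 ->.
  by rewrite /v mulr0 oppr0 expR0 addr0 mulr1.
rewrite [leRHS](bigID (mem B0))/=; apply: ler_pM => //.
- by rewrite big_seq; apply: prodr_ge0 => s /B0T /mD /floor_factor_gt0 /ltW.
- apply: (@le_trans _ _ (\prod_(s <- B' | s \in B0) floor_factor m (D s))).
    rewrite -[leRHS]big_filter; apply: ler_prod_subseq => //.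
    - exact: filter_uniq.
    - by move=> s; rewrite mem_filter => /andP[].
    - by move=> s /B0T /mD Ds; rewrite ltW ?floor_factor_gt0//= floor_factor_le1// ltW.
  rewrite big_seq_cond [leRHS]big_seq_cond; apply: ler_prod => s /andP[sB' _].
  have Ds := mD _ (B'T _ sB').
  by rewrite ltW ?floor_factor_gt0//= factor_ge_floor// lm// B't.
- pose B1 := [seq s <- B' | s \notin B0].
  have B1B' s : s \in B1 -> s \in B' by rewrite mem_filter => /andP[].
  have B1B0 s : s \in B1 -> s \notin B0 by rewrite mem_filter => /andP[].
  have okB1 : ok B1 by split=> [|s /B1B' /B'T//]; rewrite filter_uniq.
  have g_le s : s \in B1 -> g s <= e.
    move=> sB1; rewrite -[g s](big_seq1 +%R) tail//; last first.
      by move=> u; rewrite inE => /eqP->; exact: B1B0.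
    by split=> // u; rewrite inE => /eqP->; exact: okB1.2.
  rewrite -big_filter -/B1.
  apply: le_trans (ler_1Bsum_prod (x := fun s => (l s * D s) ^+ 2) _ _).
  + have : \sum_(s <- B1) (l s * D s) ^+ 2 <= 2 * m ^+ 2 * e.
      apply: (@le_trans _ _ (2 * m ^+ 2 * \sum_(s <- B1) g s)); last first.
        by rewrite ler_pM2l ?mulr_gt0 ?exprn_gt0// tail.
      rewrite mulr_sumr big_seq [leRHS]big_seq; apply: ler_sum => s sB1.
      have /andP[l0 lm'] := lm s (B't s (B1B' s sB1)).
      have Dg : D s ^+ 2 <= 2 * g s.
        by apply: sqr_le_sqr_expRB1; rewrite (le_trans (g_le s sB1))// ge_min lexx.
      rewrite exprMn (_ : 2 * m ^+ 2 * g s = m ^+ 2 * (2 * g s)); last by ring.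
      by apply: ler_pM; rewrite ?sqr_ge0// ler_pXn2r// nnegrE// ltW.
    have em : 2 * m ^+ 2 * e <= 2^-1.
      have m2 : 0 < m ^+ 2 by rewrite exprn_gt0.
      have : e <= (4 * m ^+ 2)^-1 by rewrite ge_min lexx orbT.
      rewrite -(ler_pM2l (x := 2 * m ^+ 2)) ?mulr_gt0// => /le_trans; apply.
      by rewrite le_eqVlt; apply/orP; left; apply/eqP; field; rewrite gt_eqF.
    lra.
  + by move=> s /B1B' /B't /lD; exact: compensated_factor_itv.
  + move=> s /B1B' /B't /lD h; split; first exact: sqr_ge0.
    exact: compensated_factor_ge.
Qed.
End StochasticExponentialFactors.

(** * Explosion of the deterministic inequality *)

(** The left-hand side is the integral of the step function equal to - D on
    [0, tau[ and to - D + beta on [tau, t]. *)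
Lemma integral_step_ge (R : realType) (t tau D beta : R) (f : R -> R) :
  0 <= tau <= t ->
  (forall s, 0 <= s <= t -> - D <= f s) ->
  (forall s, tau <= s <= t -> - D + beta <= f s) ->
  ((- D * t + beta * (t - tau))%:E <=
    \int[@lebesgue_measure R]_(s in `[0%R, t]) (f s)%:E)%E.
Proof.
move=> /andP[tau0 taut] fD fb; have t0 := le_trans tau0 taut.
pose g (s : R) : \bar R := ((- D)%:E + (beta * \1_(`[tau, t] : set R) s)%:E)%E.
apply: (@le_trans _ _ (\int[@lebesgue_measure R]_(s in `[0%R, t]) g s)%E); last first.
  apply: le_integral_monotone => s; rewrite /= in_itv/= => st.
  rewrite /g indicE -EFinD lee_fin; case: (boolP (s \in _)).
    by rewrite mem_setE in_itv/= mulr1; exact: fb.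
  by rewrite mulr0 addr0 => _; exact: fD.
have mu_itv (u : R) : u <= t -> @lebesgue_measure R `[u, t]%classic = (t - u)%:E.
  rewrite le_eqVlt lebesgue_measure_itv/= lte_fin => /predU1P[->|->//].
  by rewrite ltxx subrr.
have i1 : (@lebesgue_measure R).-integrable `[0%R, t] (cst (- D)%:E).
  by apply/integrableP; split => //; rewrite integral_cst//= mu_itv// ltry.
have i0 : (@lebesgue_measure R).-integrable `[0%R, t]
    (fun s => (\1_(`[tau, t] : set R) s)%:E).
  apply/integrableP; split; first by apply/measurable_EFinP; apply: measurable_indic.
  under eq_integral => s _ do rewrite /= ger0_norm//.
  rewrite integral_indic//; apply: (@le_lt_trans _ _ (@lebesgue_measure R `[0, t]%classic)).
    by apply: le_measure; rewrite ?inE//; exact: measurableI.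
  by rewrite mu_itv// ltry.
under eq_integral => s _ do rewrite /g EFinM.
rewrite (integralD _ i1 (integrableZl _ beta i0))// integral_cst// integralZl//.
rewrite integral_indic// (_ : _ `&` _ = `[tau, t]%classic); last first.
  apply/setIidPl => s; rewrite /= !in_itv/= => /andP[taus ->].
  by rewrite (le_trans tau0).
rewrite [X in (_ <= _ * X + _)%E](_ : _ = (t - 0)%:E); last exact: mu_itv.
rewrite [X in (_ <= _ + _ * X)%E](_ : _ = (t - tau)%:E); last exact: mu_itv.
by rewrite subr0 -!EFinM -EFinD.
Qed.

Section BlowUp.
Context (R : realType) (lam r : R -> R -> R) (J' : R -> R).
Context (T gamma a0 b0 C lm lM kappa H : R).
Hypothesis T_gt0 : 0 < T.
Hypothesis gamma_gt0 : 0 < gamma.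
Hypothesis a0_gt0 : 0 < a0.
Hypothesis C_ge0 : 0 <= C.
Hypothesis lm_gt0 : 0 < lm.
Hypothesis lam_itv : forall t x, 0 <= t <= T -> 0 <= x -> lm <= lam t x <= lM.
Hypothesis J'_ge : forall z, 0 <= z -> - C <= J' z.
Hypothesis J'_growth : forall z, 0 < z -> a0 * ln z ^+ 3 + b0 <= J' z.
Hypothesis r_LL2 : in_LL2gamma T gamma r.

Local Notation mu := (@lebesgue_measure R).

(** The argument of J' in the equation, along the maturities [0, X]. *)
Let bond (s X : R) : R := \int[mu]_(v in `[0, X]) (lam s v * r s v).

Hypothesis r_ge : forall t x, 0 <= t <= T -> 0 <= x -> t + x <= T ->
  (kappa%:E * expeR (\int[mu]_(s in `[0%R, t])
     (J' (bond s (t - s + x)) * lam s (t - s + x))%:E) <= (r t x)%:E)%E.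

Hypothesis kappa_ge : expR (H + C * lM * T) <= kappa.
Hypothesis H_ge1 : 1 <= H.
Hypothesis H_length : 8 <= lm * T * H.
Hypothesis H_offset : 16 * `|b0| <= a0 * H.
Hypothesis H_rate : 128 <= lm * T * a0 * H.

Let lM_gt0 : 0 < lM.
Proof.
have zT : 0 <= (0 : R) <= T by rewrite lexx ltW.
by have /andP[h1 h2] := lam_itv zT (lexx 0); rewrite (lt_le_trans lm_gt0)// (le_trans h1).
Qed.

Let lam_r_ge0 s v : 0 <= s <= T -> 0 <= v -> 0 <= lam s v * r s v.
Proof.
move=> sT v0; have [r0 _ _] := r_LL2; have /andP[h _] := lam_itv sT v0.
by rewrite mulr_ge0 ?r0// (le_trans (ltW lm_gt0)).
Qed.

(** lam * r <= lM * (1 + r^2 exp(gamma v)). Finiteness matters because the real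
    integral takes the value 0 when the extended one is infinite. *)
Let bond_integral_lty s X : 0 <= s <= T -> 0 <= X ->
  (\int[mu]_(v in `[0%R, X]) (lam s v * r s v)%:E < +oo)%E.
Proof.
move=> sT X0; have [r0 mr r2] := r_LL2.
pose h (v : R) : \bar R := (`|r s v| ^+ 2 * expR (gamma * v))%:E.
have h0 v : (0 <= h v)%E by rewrite lee_fin mulr_ge0 ?expR_ge0// sqr_ge0.
have mrX : measurable_fun (`[0, X] : set R) (r s).
  apply: measurable_funS (mr s sT) => //.
  by move=> v; rewrite /= !in_itv/= andbT => /andP[].
have mh : measurable_fun (`[0, X] : set R) h.
  apply/measurable_EFinP; apply: measurable_funM.
    by apply: measurable_funX; apply: measurableT_comp.
  by apply: measurableT_comp => //; apply: measurable_funM.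
have hlty : (\int[mu]_(v in `[0%R, X]) h v < +oo)%E.
  apply: le_lt_trans r2.
  apply: (@le_trans _ _ (L2gamma_norm2 gamma (r s))); last first.
    by apply: ereal_sup_ubound; exists s => //=; rewrite in_itv.
  rewrite /L2gamma_norm2 integral_mkcond [leRHS]integral_mkcond.
  apply: le_integral_monotone => v _; rewrite /patch.
  case: ifPn => [|_]; last by case: ifPn => // _; exact: h0.
  by rewrite mem_setE in_itv/= => /andP[v0 _]; rewrite mem_setE in_itv/= v0.
apply: (@le_lt_trans _ _ (\int[mu]_(v in `[0%R, X]) (lM%:E * (1 + h v)))%E).
  apply: le_integral_monotone => v; rewrite /= in_itv/= => /andP[v0 _].
  rewrite /h -EFinD -EFinM lee_fin.
  have /andP[_ h2] := lam_itv sT v0; have rv0 := r0 s v sT v0.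
  rewrite ger0_norm//; apply: (@le_trans _ _ (lM * r s v)); first by rewrite ler_wpM2r.
  rewrite ler_pM2l//; have : 1 <= expR (gamma * v) by rewrite -expR0 ler_expR mulr_ge0// ltW.
  move: (expR _) => E E1; apply: (@le_trans _ _ (1 + r s v ^+ 2 * 1)).
    by rewrite mulr1; have := sqr_ge0 (r s v - 1); nra.
  by rewrite lerD2l ler_wpM2l// sqr_ge0.
have muX : (mu `[0%R, X]%classic < +oo)%E.
  by rewrite lebesgue_measure_itv/=; case: ifP => // _; rewrite -EFinB ltry.
have m1h : measurable_fun (`[0, X] : set R) (fun v => 1 + h v)%E by exact: emeasurable_funD.
rewrite ge0_integralZl//; last 2 first.
  by move=> v _; rewrite adde_ge0.
  by rewrite lee_fin ltW.
rewrite lte_mul_pinfty// ?lee_fin ?(ltW lM_gt0)//.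
rewrite ge0_integralD// integral_cst// mul1e lte_add_pinfty//.
Qed.

Let bond_ge0 s X : 0 <= s <= T -> 0 <= bond s X.
Proof.
move=> sT; apply: Rintegral_ge0 => v; rewrite /= in_itv/= => /andP[v0 _].
exact: lam_r_ge0.
Qed.

Let bond_ge s X c A : 0 <= s <= T -> 0 <= c <= X -> 0 <= A ->
  (forall v, c <= v <= X -> A <= r s v) -> lm * A * (X - c) <= bond s X.
Proof.
move=> sT /andP[c0 cX] A0 rA; have X0 := le_trans c0 cX.
have fin : (\int[mu]_(v in `[0%R, X]) (lam s v * r s v)%:E \is a fin_num)%E.
  rewrite ge0_fin_numE ?bond_integral_lty//; apply: integral_ge0 => v.
  by rewrite /= in_itv/= => /andP[v0 _]; rewrite lee_fin lam_r_ge0.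
rewrite -lee_fin /bond /Rintegral fineK//.
have cX0 : 0 <= c <= X by rewrite c0.
have := @integral_step_ge R X c 0 (lm * A) (fun v => lam s v * r s v) cX0.
rewrite oppr0 mul0r !add0r; apply=> v.
  by move=> /andP[v0 _]; exact: lam_r_ge0.
move=> /andP[cv vX]; have v0 := le_trans c0 cv.
have /andP[h1 _] := lam_itv sT v0.
by apply: ler_pM; rewrite ?(ltW lm_gt0)// rA// cv.
Qed.

Let drift t x s : R := J' (bond s (t - s + x)) * lam s (t - s + x).

Let drift_ge t x s : 0 <= t <= T -> 0 <= x -> 0 <= s <= t -> - (C * lM) <= drift t x s.
Proof.
move=> /andP[t0 tT] x0 /andP[s0 st].
have sT : 0 <= s <= T by rewrite s0 (le_trans st).
have X0 : 0 <= t - s + x by rewrite addr_ge0// subr_ge0.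
have := J'_ge (bond_ge0 (t - s + x) sT); have /andP[h1 h2] := lam_itv sT X0.
rewrite /drift; move: (J' _) (lam _ _) h1 h2 => j l h1 h2 hj.
have j0 : 0 <= j + C by lra.
have l0 : 0 <= l := le_trans (ltW lm_gt0) h1.
have := mulr_ge0 j0 l0.
have : 0 <= C * (lM - l) by rewrite mulr_ge0// subr_ge0.
lra.
Qed.

Let r_exp_ge t x tau beta : 0 <= t <= T -> 0 <= x -> t + x <= T -> 0 <= tau <= t ->
  (forall s, tau <= s <= t -> - (C * lM) + beta <= drift t x s) ->
  expR (H + beta * (t - tau)) <= r t x.
Proof.
move=> tT x0 txT taut hb; have /andP[t0 tT'] := tT; have /andP[tau0 tau_t] := taut.
rewrite -lee_fin; apply: le_trans (r_ge tT x0 txT).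
have lower := @integral_step_ge R t tau (C * lM) beta (drift t x) taut.
have {}lower : ((- (C * lM) * t + beta * (t - tau))%:E <=
    \int[mu]_(s in `[0%R, t]) (drift t x s)%:E)%E.
  by apply: lower => s hs; [exact: drift_ge|exact: hb].
apply: (@le_trans _ _ (kappa%:E * expeR (- (C * lM) * t + beta * (t - tau))%:E)%E).
  rewrite /= -EFinM lee_fin; apply: le_trans (ler_wpM2r (expR_ge0 _) kappa_ge).
  rewrite -expRD ler_expR; have : 0 <= C * lM * (T - t).
    by rewrite !mulr_ge0 ?subr_ge0// ltW.
  lra.
rewrite lee_pmul2l ?lee_expeR// lte_fin; apply: lt_le_trans kappa_ge; exact: expR_gt0.
Qed.

(** The times at which the successive levels are reached: T/4, T/8, ... apart. *)
Let tick (n : nat) : R := T / 2 * (1 - (2 ^+ n)^-1).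

(** One stage: with N = 2^n and dl the length of the step, f >= exp(H N) on the
    previous domain makes the argument of J' at least lm * dl * exp(H N), which
    exceeds exp(H N / 2) because H is large compared with 1 / (lm T). Hence J' is of
    order (H N)^3, and dl * (H N)^3 is of order H^3 N^2, beyond 2 H N. *)
Let cascade (n : nat) (t x : R) : tick n <= t -> t <= T / 2 -> T / 2 + tick n <= t + x ->
  t + x <= T -> expR (H * 2 ^+ n) <= r t x.
Proof.
have T0 := T_gt0; have H1 := H_ge1; have Ho := H_offset; have Hr := H_rate.
have Hl := H_length.
elim: n t x => [|n IH] t x.
  rewrite /tick expr0 invr1 subrr mulr0 addr0 mulr1 => t0 tT tx txT.
  have tT' : 0 <= t <= T by rewrite t0; lra.
  have x0 : 0 <= x by lra.
  have tt : 0 <= t <= t by rewrite t0 lexx.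
  have := @r_exp_ge t x t 0 tT' x0 txT tt.
  rewrite mul0r !addr0; apply => s /andP[ts st].
  by rewrite drift_ge// (le_trans t0 ts).
set N := 2 ^+ n in IH *.
have N1 : 1 <= N by rewrite /N exprn_ege1// ler1n.
have N0 : 0 < N by lra.
pose dl := T / (4 * N).
have dl0 : 0 < dl by rewrite divr_gt0// mulr_gt0.
have tickS : tick n.+1 = tick n + dl.
  by rewrite /tick /dl exprS -/N; field; rewrite gt_eqF.
have tick0 : 0 <= tick n.
  rewrite /tick mulr_ge0 ?divr_ge0 ?(ltW T_gt0)// subr_ge0 -/N invf_le1//.
rewrite tickS => t_ge tT txge txT.
have t0 : 0 <= t by lra.
have tT' : 0 <= t <= T by rewrite t0; lra.
have x0 : 0 <= x by lra.
have tau : 0 <= tick n <= t by rewrite tick0; lra.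
pose beta := lm * (a0 * (H * N) ^+ 3 / 16).
have H0 : 0 < H by lra.
have HN0 : 0 < H * N by rewrite mulr_gt0.
have beta0 : 0 <= a0 * (H * N) ^+ 3 / 16.
  by rewrite divr_ge0// mulr_ge0 ?exprn_ge0// ltW.
have beta_ge0 : 0 <= beta by rewrite /beta mulr_ge0// ltW.
apply: le_trans (r_exp_ge tT' x0 txT tau (beta := beta) _).
  rewrite ler_expR exprS -/N.
  apply: (@le_trans _ _ (beta * dl)); last first.
    have : 0 <= beta * (t - tick n - dl).
      by rewrite mulr_ge0// ?mulr_ge0 ?(ltW lm_gt0)//; lra.
    lra.
  have -> : beta * dl = (lm * T * a0 * H) * (H * N) ^+ 2 / 64.
    by rewrite /beta /dl; field; rewrite gt_eqF.
  have HN1 : 1 <= H * N by nra.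
  have : 0 <= (lm * T * a0 * H - 128) * (H * N) ^+ 2.
    by rewrite mulr_ge0 ?sqr_ge0// subr_ge0.
  nra.
move=> s /andP[s_ge st].
have s0 : 0 <= s by lra.
have sT : 0 <= s <= T by rewrite s0; lra.
set X := t - s + x.
have z_ge : expR (H * N / 2) <= bond s X.
  have cX : 0 <= T / 2 + tick n - s <= X by rewrite /X; apply/andP; split; lra.
  have rA v : T / 2 + tick n - s <= v <= X -> expR (H * N) <= r s v.
    by rewrite /X => /andP[cv vX]; apply: IH; lra.
  apply: le_trans (bond_ge sT cX (expR_ge0 _) rA).
  have EE : expR (H * N) = expR (H * N / 2) * expR (H * N / 2) by rewrite -expRD -splitr.
  have E1 : H * N / 2 <= expR (H * N / 2) by have := expR_ge1Dx (H * N / 2); lra.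
  have E0 := expR_gt0 (H * N / 2).
  have lmdl : 1 <= lm * dl * expR (H * N / 2).
    apply: (@le_trans _ _ (lm * dl * (H * N / 2))); last first.
      by rewrite ler_wpM2l// mulr_ge0 ?ltW.
    have -> : lm * dl * (H * N / 2) = lm * T * H / 8.
      by rewrite /dl; field; rewrite gt_eqF.
    lra.
  apply: (@le_trans _ _ (lm * expR (H * N) * dl)).
    by rewrite EE; move: (expR _) E0 lmdl => E E0 lmdl; nra.
  by rewrite ler_wpM2l ?mulr_ge0 ?expR_ge0 ?(ltW lm_gt0)// /X; lra.
have z0 : 0 < bond s X by apply: lt_le_trans z_ge; exact: expR_gt0.
have ln_ge : H * N / 2 <= ln (bond s X).
  by rewrite -[leLHS]expRK ler_ln ?posrE ?expR_gt0.
have J_ge : a0 * (H * N) ^+ 3 / 16 <= J' (bond s X).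
  apply: le_trans (J'_growth z0).
  have : (H * N / 2) ^+ 3 <= ln (bond s X) ^+ 3.
    by rewrite lerXn2r// nnegrE; lra.
  rewrite -(ler_pM2l a0_gt0) exprMn => h3.
  have hb0 := ler_norm (- b0); rewrite normrN in hb0.
  have HN3 : a0 * H <= a0 * (H * N) ^+ 3.
    rewrite ler_pM2l// (@le_trans _ _ (H * N))//; first by nra.
    by rewrite -[leLHS]expr1 ler_weXn2l//; nra.
  have e8 : (2^-1 : R) ^+ 3 = 8^-1 by rewrite exprVn -natrX.
  rewrite e8 in h3; lra.
have X0 : 0 <= X by rewrite /X; lra.
have /andP[l1 _] := lam_itv sT X0.
rewrite /drift -/X /beta; apply: (@le_trans _ _ (lm * (a0 * (H * N) ^+ 3 / 16))).
  by rewrite gerDr oppr_le0 mulr_ge0// ltW.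
by rewrite [leRHS]mulrC; apply: ler_pM; rewrite // ltW.
Qed.

(** The point (T/2, T/2) belongs to the domain of every stage of the cascade. *)
Lemma blow_up : False.
Proof.
have T2 : 0 <= T / 2 by rewrite divr_ge0// ltW.
have tickT n : tick n <= T / 2.
  by rewrite /tick ler_piMr// gerBl invr_ge0 exprn_ge0.
have [n nr] : exists n : nat, r (T / 2) (T / 2) < n%:R.
  by exists (Num.bound (r (T / 2) (T / 2))); exact: unstable.ltr_bound.
have := @cascade n (T / 2) (T / 2) (tickT n) (lexx _).
rewrite lerD2l -splitr => /(_ (tickT n) (lexx _)).
rewrite leNgt => /negP; apply; apply: (lt_le_trans nr).
apply: le_trans (expR_ge1Dx _).
have : n%:R <= 2 ^+ n :> R by rewrite -natrX ler_nat ltnW// ltn_expl.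
have : 0 <= 2 ^+ n :> R by rewrite exprn_ge0.
have := H_ge1; nra.
Qed.
End BlowUp.

(** * Positive lower level of the stochastic exponential, and non-existence *)

Lemma ae_exists_not_negligible d (T : measurableType d) (R : realType)
    (P : probability T R) (A : nat -> set T) :
  {ae P, forall w, exists n, A n w} -> exists n, ~ P.-negligible (A n).
Proof.
move=> aeA; apply: contrapT => /forallNP negA.
have : P.-negligible (\bigcup_n A n `|` ~` [set w | exists n, A n w]).
  apply: negligibleU; last exact: aeA.
  by apply: negligible_bigcup => n; exact: contrapT (negA n).
rewrite (_ : _ `|` _ = setT); last first.
  apply/seteqP; split=> // w _; have [[n Anw]|nA] := pselect (exists n, A n w).
    by left; exists n.
  by right.
move=> /(measure_negligible measurableT) P0.
have : (1 = 0 :> \bar R)%E := etrans (esym (probability_setT P)) P0.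
by move=> /eqP; rewrite eqe oner_eq0.
Qed.

Lemma Rintegral_sqr_le (R : realType) (f : R -> R) (t m : R) : 0 <= t -> 0 <= m ->
  (forall s, 0 <= s <= t -> 0 <= f s <= m) ->
  \int[@lebesgue_measure R]_(s in `[0, t]) (f s) ^+ 2 <= m ^+ 2 * t.
Proof.
move=> t0 m0 fm.
have mu0t : @lebesgue_measure R `[0, t]%classic = t%:E.
  rewrite lebesgue_measure_itv/= lte_fin -EFinB subr0.
  by move: t0; rewrite le_eqVlt => /predU1P[<-|->//]; rewrite ltxx.
have le_int : (\int[@lebesgue_measure R]_(s in `[0%R, t]) ((f s) ^+ 2)%:E <= (m ^+ 2 * t)%:E)%E.
  apply: (@le_trans _ _ (\int[@lebesgue_measure R]_(s in `[0%R, t]) cst (m ^+ 2)%:E s)%E).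
    apply: le_integral_monotone => s; rewrite /= in_itv/= => /fm/andP[f0 fm'].
    by rewrite lee_fin ler_pXn2r// nnegrE.
  rewrite integral_cst// [X in (_ * X <= _)%E](_ : _ = t%:E)//.
have ge0 : (0 <= \int[@lebesgue_measure R]_(s in `[0%R, t]) ((f s) ^+ 2)%:E)%E.
  by apply: integral_ge0 => s _; rewrite lee_fin sqr_ge0.
rewrite -lee_fin /Rintegral fineK// ge0_fin_numE//.
by apply: le_lt_trans le_int _; rewrite ltry.
Qed.

(** The stochastic integral is bounded by assumption and the integral of lambda^2 by
    lM^2 * Tstar; the product is bounded below by the control of the jumps. *)
Lemma ae_btilde_bounded_below (R : realType) d (T : measurableType d)
    (P : probability T R) (F : R -> set (set T)) (L : R -> T -> R)
    (a q : R) (nu : {measure set (measurableTypeR R) -> \bar R})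
    (lam : R -> R -> R) (I : R -> R -> T -> R) (Tstar lM c : R) :
  0 < Tstar -> is_filtration F -> is_levy_process P F L ->
  0 <= q -> is_levy_measure nu -> has_levy_exponent P L a q nu ->
  0 < c < lM^-1 -> nu `]-oo, - c]%classic = 0%E -> 0 < lM ->
  (forall t x, 0 <= t <= Tstar -> 0 <= x -> 0 <= lam t x <= lM) ->
  {ae P, forall w, exists M : R, forall t x : R,
    0 <= t <= Tstar -> 0 <= x -> `|I t x w| <= M} ->
  {ae P, forall w, exists n : nat, forall t x : R,
    0 <= t <= Tstar -> 0 <= x -> n.+1%:R^-1 <= btilde lam q L I t x w}.
Proof.
move=> T0 F_filt L_levy q0 nu_levy L_exp /andP[c0 ck] nu0 lM0 lam_itv aeI.
have laplace z t : 0 <= z -> 0 <= t -> ('E_P[fun w => expR (- (z * L t w))] =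
    (expR (t * levy_exponent a q nu z))%:E)%E.
  by move=> z0 t0; apply: L_exp t0; exact: (exp_moment_finite nu_levy nu0 z0).
have k0 : 0 < lM^-1 by rewrite invr_gt0.
set M := \int[nu]_y Num.min (y ^+ 2) 1.
have M0 : 0 <= M by apply: Rintegral_ge0 => y _; rewrite le_min sqr_ge0 ler01.
have rate_le z : 0 <= z -> levy_exponent a q nu (2 * z) - 2 * levy_exponent a q nu z <=
    (q + M) * (1 + z ^+ 2) * expR (2 * z * c).
  move=> z0; apply: (le_trans (levy_exponent_variance_le a q nu_levy c0 nu0 z0)).
  rewrite -/M; have : 1 <= expR (2 * z * c).
    by rewrite -expR0 ler_expR !mulr_ge0// ltW.
  move: (expR _) => E E1; have z2 := sqr_ge0 z.
  have : q * z ^+ 2 <= q * ((1 + z ^+ 2) * E) by rewrite ler_wpM2l//; nra.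
  lra.
have sums := ae_sum_jumps_bounded F_filt L_levy laplace T0.
have gts := ae_jumps_gt F_filt L_levy laplace T0 ck k0 (addr_ge0 q0 M0) rate_le.
move: aeI; apply: filterS3 sums gts => w [S SP] jgt [B IB].
have D0 s : s <= 0 -> jump (L ^~ w) s = 0 by rewrite /jump; case: ltP.
have [p p0 prod_ge] := unordered_prod_compensated_bounded_below lM0 D0 jgt SP.
pose dl := expR (- B - q / 2 * (lM ^+ 2 * Tstar)) * p.
have dl0 : 0 < dl by rewrite mulr_gt0 ?expR_gt0.
exists (Num.bound dl^-1) => t x tT x0; have /andP[t0 tT'] := tT.
have lam_diag s : 0 <= s <= t -> 0 <= lam s (t - s + x) <= lM.
  move=> /andP[s0 st]; apply: lam_itv; first by rewrite s0 (le_trans st).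
  by rewrite addr_ge0// subr_ge0.
apply: (@le_trans _ _ dl).
  rewrite -[leRHS]invrK lef_pV2 ?posrE ?invr_gt0 ?ltr0n//.
  apply: (le_trans (ltW (unstable.ltr_bound dl^-1))).
  by rewrite ler_nat.
apply: ler_pM; rewrite ?expR_ge0 ?(ltW p0)//.
  rewrite ler_expR; have := IB t x tT x0; rewrite ler_norml => /andP[hI _].
  have hsq := Rintegral_sqr_le t0 (ltW lM0) lam_diag.
  apply: lerB => //; apply: ler_wpM2l; first by rewrite divr_ge0.
  apply: (le_trans hsq); by rewrite ler_wpM2l ?sqr_ge0.
exact: (prod_ge t (fun s => lam s (t - s + x)) tT lam_diag).
Qed.

Theorem theorem4p2 (R : realType) (d : measure_display) (T : measurableType d)
  (P : probability T R) (F : R -> set (set T)) (L : R -> T -> R)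
  (a q : R) (nu : {measure set (measurableTypeR R) -> \bar R})
  (lam : R -> R -> R) (I : R -> R -> T -> R) (Tstar gamma a0 b0 : R)
  (Tstar_gt0 : 0 < Tstar) (gamma_gt0 : 0 < gamma)
  (F_filtration : is_filtration F)
  (L_levy : is_levy_process P F L)
  (q_ge0 : 0 <= q) (nu_levy : is_levy_measure nu)
  (L_exponent : has_levy_exponent P L a q nu)
  (lam_continuous : forall x : R, 0 <= x ->
    {within `[0, +oo[, continuous (fun t : R => lam t x)})
  (lam_lbound : has_lbound (lam_values lam Tstar))
  (lam_inf_gt0 : 0 < lam_inf lam Tstar)
  (lam_ubound : has_ubound (lam_values lam Tstar))
  (I_integral : forall t x : R, 0 <= t <= Tstar -> 0 <= x ->
    is_levy_integral P L (fun s => lam s (t - s + x)) t (I t x))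
  (A2 : measure_support nu `<=` [set y | - (lam_sup lam Tstar)^-1 < y])
  (A3 : {ae P, forall w, exists M : R, forall t x : R,
    0 <= t <= Tstar -> 0 <= x -> `|I t x w| <= M})
  (A4 : (\int[nu]_(y in `](- (lam_sup lam Tstar)^-1)%R, 1%R[) (y ^+ 2)%:E +
         \int[nu]_(y in `[1%R, +oo[) y%:E < +oo)%E)
  (a0_gt0 : 0 < a0)
  (J'_growth : forall z : R, 0 < z ->
    a0 * ln z ^+ 3 + b0 <= levy_exponent_deriv a q nu z) :
  exists K : R, 0 < K /\
    forall r0 : R -> R,
      (forall x : R, 0 <= x -> 0 < r0 x) ->
      (forall x : R, 0 <= x <= Tstar -> K < r0 x) ->
      ~ exists r : R -> R -> T -> R,
          is_solution P F Tstar r0 lam a q nu L I r /\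
          {ae P, forall w, in_LL2gamma Tstar gamma (fun t x : R => r t x w)}.
Proof.
set lM := lam_sup lam Tstar; set lm := lam_inf lam Tstar.
have lam_itv t x : 0 <= t <= Tstar -> 0 <= x -> lm <= lam t x <= lM.
  move=> tT x0; have val : lam_values lam Tstar (lam t x) by exists t, x.
  by rewrite ge_inf// ub_le_sup.
have lM_gt0 : 0 < lM.
  have zT : 0 <= (0 : R) <= Tstar by rewrite lexx ltW.
  have /andP[h1 h2] := lam_itv 0 0 zT (lexx 0).
  by rewrite (lt_le_trans lam_inf_gt0)// (le_trans h1).
have k_gt0 : 0 < lM^-1 by rewrite invr_gt0.
have [c ck nu_below] := measure0_below_support k_gt0 A2.
have mean_lty : (\int[nu]_(y in `[1%R, +oo[) y%:E < +oo)%E.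
  apply: le_lt_trans A4; apply: leeDr; apply: integral_ge0 => y _.
  by rewrite lee_fin sqr_ge0.
have c_gt0 : 0 < c by case/andP: ck.
have [C C_ge0 J'_ge] :=
  levy_exponent_deriv_bounded_below a nu_levy c_gt0 nu_below q_ge0 mean_lty.
have lam_itv0 t x : 0 <= t <= Tstar -> 0 <= x -> 0 <= lam t x <= lM.
  by move=> tT x0; have /andP[h1 ->] := lam_itv t x tT x0; rewrite (le_trans (ltW lam_inf_gt0)).
have [n n_pos] := ae_exists_not_negligible (ae_btilde_bounded_below Tstar_gt0
  F_filtration L_levy q_ge0 nu_levy L_exponent ck nu_below lM_gt0 lam_itv0 A3).
(* One summand for each of the four conditions on H in the explosion lemma. *)
pose H := 1 + 8 / (lm * Tstar) + 16 * `|b0| / a0 + 128 / (lm * Tstar * a0).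
have lmT : 0 < lm * Tstar by rewrite mulr_gt0.
have lmTa : 0 < lm * Tstar * a0 by rewrite mulr_gt0.
have H1 : 0 <= 8 / (lm * Tstar) by rewrite divr_ge0// ltW.
have H2 : 0 <= 16 * `|b0| / a0 by rewrite divr_ge0 ?mulr_ge0// ltW.
have H3 : 0 <= 128 / (lm * Tstar * a0) by rewrite divr_ge0// ltW.
pose kappa := expR (H + C * lM * Tstar).
have n1 : 0 < n.+1%:R :> R by rewrite ltr0n.
exists (kappa * n.+1%:R); split; first by rewrite mulr_gt0 ?expR_gt0.
move=> r0 _ r0_gt [r [[_ _ r_eq] r_LL2]].
(* If the solution had its properties almost surely, the event on which b is at
   least 1 / (n + 1) would be contained in a null set. *)
apply: n_pos.
have : {ae P, forall w, ~ (forall t x, 0 <= t <= Tstar -> 0 <= x ->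
    n.+1%:R^-1 <= btilde lam q L I t x w)}; last first.
  by apply: negligibleS => w /= hw; apply; exact: hw.
move: r_eq r_LL2; apply: filterS2 => w w_eq w_LL2 w_b.
apply: (@blow_up R lam (fun t x => r t x w) (levy_exponent_deriv a q nu) Tstar gamma
  a0 b0 C lm lM kappa H) => //.
- move=> t x tT x0 txT; rewrite (w_eq t x tT x0).
  apply: lee_wpmul2r; first exact: expeR_ge0.
  rewrite lee_fin /atilde; have /andP[t0 _] := tT.
  have := r0_gt (t + x); rewrite addr_ge0// txT => /(_ isT) /ltW K_le.
  rewrite -[leLHS](mulfK (lt0r_neq0 n1)).
  apply: ler_pM => //; first by rewrite mulr_ge0 ?expR_ge0// ltW.
  exact: w_b.
- by rewrite /H; lra.
- by rewrite /H -(ler_pdivrMl _ _ lmT) mulrC; lra.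
- by rewrite /H -(ler_pdivrMl _ _ a0_gt0) mulrC; lra.
- by rewrite /H -(ler_pdivrMl _ _ lmTa) mulrC; lra.
Qed.
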